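(* Let $P$ be a probability distribution over $\Theta$ (the prior over score function parameters) that does not depend on the data. Let $D_N=\{(x_i,y_i)\}_{i=1}^N$ be a set of $N\ge 2$ i.i.d. samples from $\mathcal{D}$, let $\gamma>0$, and let $\hat\alpha\in(0,1)$ with $(N+1)\hat\alpha\ge 1$. Let the efficiency $\ell_{\mathrm{eff}}(C)$ of a predicted set $C$ always lie within $[0,1]$. Assume that the score function is bounded by $\beta$, i.e. $|s(x,y;\theta)|<\beta$ for all $x,y,\theta$, and that the map $\tau\mapsto\ell_{\mathrm{eff}}(C(x;\tau,\theta))$ is $L_\tau$-Lipschitz continuous in $\tau$ for all $x\in\mathcal{X}$ and all values of $\theta\in\Theta$. Then, with probability greater than $1-\gamma$ over the sampling of $D_N$, for all probability distributions $Q$ over $\Theta$, $$\mathcal{L}_{\mathrm{eff}}(Q)\le\mathbb{E}_{\theta\sim Q}\left[\frac1N\sum_{i=1}^N\ell_{\mathrm{eff}}\big(C(x_i;\tau^*(D_N,\hat\alpha;\theta),\theta)\big)\right]+\frac{2\beta L_\tau}{\sqrt N}+\frac{\sqrt{\frac12\mathrm{KL}(Q\Vert P)+\frac12\log\left(\frac{2N}{\gamma}\right)}}{\sqrt{N-1}}.$$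
   Context: Setting: $\mathcal{X}$ is an input space, $\mathcal{Y}$ a label space, $\mathcal{D}$ a probability distribution on $\mathcal{X}\times\mathcal{Y}$, $\Theta=\mathbb{R}^d$ a parameter space, and $s:\mathcal{X}\times\mathcal{Y}\times\Theta\to\mathbb{R}$ a (measurable) score function, written $s(x,y;\theta)$. Prediction set: for a threshold $\tau\in\mathbb{R}$, $C(x;\tau,\theta)=\{y\in\mathcal{Y}: s(x,y;\theta)\le\tau\}$. Calibrated threshold: for a data set $D_N=\{(x_i,y_i)\}_{i=1}^N$ and $\hat\alpha\in(0,1)$ with $(N+1)\hat\alpha\ge 1$, $\tau^*(D_N,\hat\alpha;\theta)$ is the $\lceil (N+1)(1-\hat\alpha)\rceil/N$ quantile of the scores $\{s(x_i,y_i;\theta)\}_{i=1}^N$, i.e. the $\lceil (N+1)(1-\hat\alpha)\rceil$-th smallest of these $N$ values. Efficiency: $\ell_{\mathrm{eff}}$ is a real-valued function of predicted sets $C\subseteq\mathcal{Y}$ (e.g. a normalized volume), to be minimized. For a probability distribution $Q$ on $\Theta$, the expected test-time efficiency is $$\mathcal{L}_{\mathrm{eff}}(Q)=\mathbb{E}_{\theta\sim Q}\Big[\mathbb{E}_{(x,y)\sim\mathcal{D}}\big[\ell_{\mathrm{eff}}\big(C(x;\tau^*(D_N,\hat\alpha;\theta),\theta)\big)\big]\Big],$$ where $(x,y)$ is independent of $D_N$; this quantity depends on $D_N$ and $\hat\alpha$. $\mathrm{KL}(Q\Vert P)$ is the Kullback–Leibler divergence. *)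

(* Defs.v *)
From HB Require Import structures.
From mathcomp Require Import all_boot all_order all_algebra.
From mathcomp Require Import all_classical all_reals all_analysis.

Set Implicit Arguments.
Unset Strict Implicit.
Unset Printing Implicit Defensive.

Import Order.TTheory GRing.Theory Num.Theory.
Import numFieldNormedType.Exports.

Local Open Scope classical_set_scope.
Local Open Scope ring_scope.
Local Open Scope charge_scope.

Section iid.
Context {dO dT : measure_display} {Omega : measurableType dO}
  {T : measurableType dT} {R : realType} (Pr : probability Omega R).

Definition mutually_independent (I : finType) (Z : I -> {RV Pr >-> T}) : Prop :=
  forall (J : {set I}) (B : I -> set T),
    (forall i, i \in J -> measurable (B i)) ->
    Pr (\bigcap_(i in [set i | i \in J]) (Z i @^-1` B i)) =
    (\prod_(i in J) Pr (Z i @^-1` B i))%E.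

Definition iid (D : probability T R) (I : finType) (Z : I -> {RV Pr >-> T})
    : Prop :=
  mutually_independent Z /\
  forall i (B : set T), measurable B -> distribution Pr (Z i) B = D B.

End iid.

(* When Q << P, the negative part of log(dQ/dP) is Q-integrable (x log x is
   bounded below), so the integral below is well defined in ]-oo, +oo]. *)
Definition KL {d : measure_display} {T : measurableType d} {R : realType}
    (Q P : probability T R) : \bar R :=
  if `[< Q `<< P >] then
    (\int[Q]_t lne (('d (charge_of_finite_measure Q) '/d P) t))%E
  else +oo%E.

Section conformal.
Context {X Y Theta : Type} {R : realType}.
Implicit Types (s : X -> Y -> Theta -> R) (th : Theta) (leff : set Y -> R).

Definition prediction_set s (x : X) (tau : R) th : set Y :=
  [set y | s x y th <= tau].

(* The ceiling is an [int]; it is positive when [alpha < 1], so that taking the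
   absolute value is only a cast to [nat]. *)
Definition calib_rank (N : nat) (alpha : R) : nat :=
  `|Num.ceil (N.+1%:R * (1 - alpha))|%N.

(* [k] counts from 1; only used for [0 < k <= size xs]. *)
Definition kth_smallest (xs : seq R) (k : nat) : R :=
  nth 0 (sort <=%R xs) k.-1.

Definition tau_star s (N : nat) (z : 'I_N -> X * Y) (alpha : R) th : R :=
  kth_smallest [seq s (z i).1 (z i).2 th | i <- enum 'I_N] (calib_rank N alpha).

(* The efficiency, at the input [x], of the prediction set calibrated on [z]. *)
Definition calib_eff s leff (N : nat) (z : 'I_N -> X * Y) (alpha : R) th
    (x : X) : R :=
  leff (prediction_set s x (tau_star s z alpha th) th).

Definition emp_eff s leff (N : nat) (z : 'I_N -> X * Y) (alpha : R) th : R :=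
  N%:R^-1 * \sum_(i < N) calib_eff s leff z alpha th (z i).1.

End conformal.

Definition exp_eff {dX dY dT : measure_display} {X : measurableType dX}
    {Y : measurableType dY} {Theta : measurableType dT} {R : realType}
    (D : probability (X * Y)%type R) (s : X -> Y -> Theta -> R)
    (leff : set Y -> R) (N : nat) (z : 'I_N -> X * Y) (alpha : R)
    (Q : probability Theta R) : \bar R :=
  (\int[Q]_th \int[D]_p (calib_eff s leff z alpha th p.1)%:E)%E.

(* Main.v *)
(* For a threshold [r], let [deviation r th z] be the expected minus the
   empirical efficiency, and let [gap] be its maximum over a grid of [6 N] steps
   of [[-beta, beta]]; the calibrated threshold is one of the scores, hence lies
   in that interval, so [gap] plus a discretization error dominates the deviation
   at the calibrated threshold, however the latter depends on the data.
   - Mean: the grid increments of the deviation are [2 L mesh / N]-stable, hence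
     sub-Gaussian, and summing their positive parts bounds the mean of [gap];
     mean and discretization error together stay below [2 beta L / sqrt N].
   - Fluctuation: [gap] changes by at most [1 / N] with each sample point, so
     McDiarmid's argument gives [E exp (l G) <= exp (l^2 / (8 N))] for the centered
     gap [G]; mixing over a Gaussian [l] gives
     [E exp (2 (N - 1) G^2) <= sqrt N].
   - PAC-Bayes: by Fubini and Markov, the average of [exp (2 (N - 1) G^2)] over the
     prior is below [2 N / gamma] with probability larger than [1 - gamma]; on
     that event the Donsker-Varadhan inequality and Jensen's inequality bound
     the [Q]-average of [G] simultaneously for all [Q]. *)
Require Import Defs.
From HB Require Import structures.
From mathcomp Require Import all_boot all_order all_algebra.
From mathcomp Require Import all_classical all_reals all_analysis.
From mathcomp Require Import measurable_realfun.
From mathcomp Require Import ring lra.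

Import Order.TTheory GRing.Theory Num.Theory.
Import numFieldNormedType.Exports.

Local Open Scope classical_set_scope.
Local Open Scope ring_scope.

(** * Hoeffding's lemma *)

Lemma is_derive_ge0_le {R : realType} (f df : R -> R) (x : R) :
  (forall y : R, is_derive y 1 f (df y)) ->
  (forall y : R, 0 < y -> 0 <= df y) -> 0 <= x -> f 0 <= f x.
Proof.
move=> fdf df0 x0; apply: (@ger0_derive1_ndecry _ f 0) => //.
- move=> y; rewrite in_itv/= andbT => y0.
  by rewrite derive1E (@derive_val _ _ _ _ _ _ _ (fdf y)); exact: df0.
- apply: continuous_subspaceT => y.
  by apply: differentiable_continuous; apply/derivable1_diffP.
Qed.

(** The left side [q] is the logarithmic derivative of [1 - p + p * expR u]. It equals [p] at 0, and
    its own derivative [q * (1 - q)] never exceeds 1/4. *)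
Lemma logistic_slope_le {R : realType} (p u : R) : 0 <= p <= 1 -> 0 <= u ->
  p * expR u / (1 - p + p * expR u) <= p + u / 4.
Proof.
move=> /andP[p0 p1] u0.
have D0 (y : R) : 0 < 1 - p + p * expR y.
  have := expR_gt0 y; nra.
pose f (y : R) := p + y / 4 - p * expR y / (1 - p + p * expR y).
pose df (y : R) := 4^-1 - p * expR y * (1 - p) / (1 - p + p * expR y) ^+ 2.
have fdf (y : R) : is_derive y 1 f (df y).
  have Dy : (1 - p + p * expR y) != 0 by rewrite gt_eqF.
  have HD : is_derive y 1 (fun z : R => 1 - p + p * expR z) (p * expR y).
    rewrite -[p * expR y]add0r.
    exact: (is_deriveD (is_derive_cst (1 - p) y 1)
      (is_deriveZ p (is_derive_expR y))).
  have HV := is_deriveZ (1 - p)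
    (@is_deriveV R (fun z => 1 - p + p * expR z) y _ 1 Dy HD).
  have HL := is_deriveD (is_derive_cst (p - 1) y 1)
    (is_deriveZ 4^-1 (is_derive_id y (1 : R))).
  (* With [D] the denominator, [p * expR z / D = 1 - (1 - p) / D], so only an inverse has to be
     differentiated. *)
  have -> : f = (cst (p - 1) + 4^-1 *: (id : R -> R^o))
      + (1 - p) *: ((fun z : R => (1 - p + p * expR z)^-1) : R -> R^o).
    apply/funext => z; rewrite /f !fctE /= /GRing.scale /=.
    by have := lt0r_neq0 (D0 z) => Dz; field.
  have -> : df y = 0 + 4^-1 *: 1 +
      (1 - p) *: (- (1 - p + p * expR y) ^- 2 *: (p * expR y)).
    by rewrite /df /GRing.scale /=; field.
  exact: is_deriveD.
have : f 0 <= f u.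
  apply: (@is_derive_ge0_le _ f df) => // y _.
  have := D0 y; set a := p * expR y => D0y.
  (* This is the arithmetic-geometric mean inequality for [1 - p] and [a], written as a square. *)
  have : df y = (1 - p - a)^+2 / (4 * (1 - p + a) ^+ 2).
    by rewrite /df -/a; field; rewrite gt_eqF.
  move=> ->; apply: divr_ge0; first exact: sqr_ge0.
  by apply: mulr_ge0; [exact: ler0n | exact: sqr_ge0].
rewrite /f expR0 !mulr1 subrK divr1 mul0r addr0 subrr subr_ge0.
by [].
Qed.

(* For [u < 0] exchange the two points of the Bernoulli law. *)
Lemma bernoulli_mgf_le {R : realType} (p u : R) : 0 <= p <= 1 ->
  1 - p + p * expR u <= expR (p * u + u ^+ 2 / 8).
Proof.
have pos (q v : R) : 0 <= q <= 1 -> 0 <= v ->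
    1 - q + q * expR v <= expR (q * v + v ^+ 2 / 8).
  move=> /[dup] q01 /andP[q0 q1] v0.
  have D0 (y : R) : 0 < 1 - q + q * expR y by have := expR_gt0 y; nra.
  rewrite -[leLHS]lnK ?posrE// ler_expR -subr_ge0.
  (* After taking logarithms, the difference of the two sides vanishes at 0, and [logistic_slope_le]
     says that its derivative is nonnegative. *)
  pose f (y : R) := q * y + y ^+ 2 / 8 - ln (1 - q + q * expR y).
  pose df (y : R) := q + y / 4 - q * expR y / (1 - q + q * expR y).
  have : f 0 <= f v; last first.
    rewrite /f expR0 mulr1 subrK ln1 mulr0 add0r expr0n/= mul0r subr0.
    by move=> /le_trans; apply.
  apply: (@is_derive_ge0_le _ f df _ _ _ v0); last first.
    by move=> y y0; rewrite subr_ge0; apply: logistic_slope_le => //; exact: ltW.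
  move=> y.
  have Dy : 1 - q + q * expR y != 0 by rewrite gt_eqF.
  have HD : is_derive y 1 (fun z : R => 1 - q + q * expR z) (q * expR y).
    rewrite -[q * expR y]add0r.
    exact: (is_deriveD (is_derive_cst (1 - q) y 1)
      (is_deriveZ q (is_derive_expR y))).
  have HN := is_deriveN (@is_derive1_comp R (@ln R)
    (fun z => 1 - q + q * expR z) y _ _ (is_derive1_ln (D0 y)) HD).
  have HL := is_deriveD (is_deriveZ q (is_derive_id y (1 : R)))
    (is_deriveZ 8^-1 (is_deriveX 2 (is_derive_id y (1 : R)))).
  have -> : f = (q *: (id : R -> R^o) + 8^-1 *: ((id : R -> R^o) ^+ 2))
      + - ((@ln R) \o (fun z : R => 1 - q + q * expR z)).
    by apply/funext => z; rewrite /f !fctE /= /GRing.scale /= [_ / 8]mulrC.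
  have -> : df y = q *: 1 + 8^-1 *: ((2 * y ^+ 2.-1) *: (1 : R)) +
      - ((1 - q + q * expR y)^-1 * (q * expR y)).
    by rewrite /df /GRing.scale /=; field.
  exact: is_deriveD.
move=> p01; have [u0|u0] := leP 0 u; first exact: pos.
have := pos (1 - p) (- u); rewrite oppr_ge0 (ltW u0) => /(_ _ isT).
have -> : 0 <= 1 - p <= 1 by lra.
move=> /(_ isT); rewrite -(ler_pM2l (expR_gt0 u)) -expRD.
rewrite mulrDr [X in _ + X]mulrCA -expRD subrr expR0 mulr1.
have -> : u + ((1 - p) * - u + (- u) ^+ 2 / 8) = p * u + u ^+ 2 / 8 by ring.
by apply: le_trans; rewrite le_eqVlt; apply/orP; left; apply/eqP; ring.
Qed.

(** * Integrals of bounded functions against a probability *)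

Section bounded_integrals.
Context {d} {T : measurableType d} {R : realType} (P : probability T R).
Implicit Types (f g : T -> R) (M : R).

Lemma integrable_bounded f M : measurable_fun setT f ->
  (forall x, `|f x| <= M) -> P.-integrable setT (EFin \o f).
Proof.
move=> mf fM; apply: measurable_bounded_integrable => //.
  exact: (le_lt_trans (probability_le1 P measurableT) (ltry 1)).
exists M; split; first exact: num_real.
by move=> x Mx y _; exact: le_trans (fM y) (ltW Mx).
Qed.

Lemma EFin_Rintegral f M : measurable_fun setT f -> (forall x, `|f x| <= M) ->
  (\int[P]_x f x)%:E = (\int[P]_x (f x)%:E)%E.
Proof.
move=> mf fM; rewrite /Rintegral fineK//.
by apply: integrable_fin_num => //; exact: integrable_bounded fM.
Qed.

Lemma Rintegral_cst1 (r : R) : \int[P]_x r = r.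
Proof.
transitivity (r * fine (P setT)); first exact: Rintegral_cst.
by rewrite probability_setT mulr1.
Qed.

Lemma probability_inhabited : exists x : T, True.
Proof.
apply: contrapT => noT; have /eqP := probability_setT P.
rewrite (_ : setT = set0) ?measure0 ?eqe 1?eq_sym ?oner_eq0//.
by rewrite -subset0 => x _; apply: noT; exists x.
Qed.

Lemma Rintegral_le f g M M' : measurable_fun setT f -> measurable_fun setT g ->
  (forall x, `|f x| <= M) -> (forall x, `|g x| <= M') ->
  (forall x, f x <= g x) -> \int[P]_x f x <= \int[P]_x g x.
Proof.
move=> mf mg fM gM fg; apply: le_Rintegral => //;
  exact: integrable_bounded.
Qed.

Lemma normr_Rintegral_le f M : measurable_fun setT f ->
  (forall x, `|f x| <= M) -> `|\int[P]_x f x| <= M.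
Proof.
move=> mf fM.
have M0 : 0 <= M.
  by have [x _] := probability_inhabited; exact: le_trans (fM x).
rewrite ler_norml; apply/andP; split.
  rewrite -[- M]Rintegral_cst1; apply: (@Rintegral_le _ _ M M) => //.
    by move=> x; rewrite normrN ger0_norm.
  by move=> x; have := fM x; rewrite ler_norml => /andP[].
rewrite -[M in leRHS]Rintegral_cst1; apply: (@Rintegral_le _ _ M M) => //.
  by move=> x; rewrite ger0_norm.
by move=> x; have := fM x; rewrite ler_norml => /andP[].
Qed.

Lemma norm_expR_le (l x M : R) : `|x| <= M -> `|expR (l * x)| <= expR (`|l| * M).
Proof.
move=> xM; rewrite ger0_norm ?expR_ge0// ler_expR.
by rewrite (le_trans (ler_norm _))// normrM ler_wpM2l.
Qed.

Lemma measurable_expRM l f : measurable_fun setT f ->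
  measurable_fun setT (fun x => expR (l * f x)).
Proof. by move=> mf; apply: measurableT_comp => //; exact: measurable_funM. Qed.

End bounded_integrals.

(** * Moment generating function of a variable of bounded oscillation *)

Lemma expR_chord {R : realType} (l a b x : R) : a <= x <= b -> a < b ->
  expR (l * x) <=
  (b - x) / (b - a) * expR (l * a) + (x - a) / (b - a) * expR (l * b).
Proof.
move=> /andP[ax xb] ab; have ba0 : 0 < b - a by rewrite subr_gt0.
pose t := (x - a) / (b - a).
have t0 : 0 <= t by apply: divr_ge0; [rewrite subr_ge0 | exact: ltW].
have t1 : t <= 1 by rewrite /t ler_pdivrMr// mul1r lerD2r.
have := @convex_expR R (Itv01 t0 t1) (l * b) (l * a).
rewrite !convRE/= /unstable.onem.
have -> : t * (l * b) + (1 - t) * (l * a) = l * x.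
  by rewrite /t; field; rewrite gt_eqF.
move=> /le_trans; apply; rewrite addrC le_eqVlt; apply/orP; left; apply/eqP.
by congr (_ * _ + _); rewrite /t; field; rewrite gt_eqF.
Qed.

Section hoeffding.
Context {d} {T : measurableType d} {R : realType} (P : probability T R).
Variables (X : T -> R) (M c : R).
Hypotheses (mX : measurable_fun setT X) (XM : forall x, `|X x| <= M)
  (Xc : forall x y, X x - X y <= c).

(** Replacing the exponential by its chord over an interval of length [c] containing the range of
    [X] reduces the claim to a two-point law with the same mean, which [bernoulli_mgf_le]
    handles. *)
Lemma hoeffding_lemma (l : R) :
  \int[P]_x expR (l * X x) <= expR (l * \int[P]_x X x + l ^+ 2 * c ^+ 2 / 8).
Proof.
have [x0 _] := probability_inhabited P.
have c0 : 0 <= c by rewrite (le_trans _ (Xc x0 x0))// subrr.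
(* When [c = 0] the variable is constant; the chord needs an interval of positive length. *)
move: c0; rewrite le_eqVlt => /predU1P[c0|c0].
  have -> : X = cst (X x0).
    apply/funext => x /=; apply: le_anti.
    by have := Xc x x0; have := Xc x0 x; rewrite -c0 !subr_le0 => -> ->.
  by rewrite /cst !Rintegral_cst1 -c0 expr0n/= mulr0 mul0r addr0.
have hX : has_inf (range X).
  split; first by exists (X x0); exists x0.
  exists (- M) => _ [x _ <-]; have := XM x; by rewrite ler_norml => /andP[].
(* The bound [c] on the oscillation makes [a + c] an upper bound of the range. *)
pose a := inf (range X); pose b := a + c.
have aX x : a <= X x by apply: ge_inf; [exact: hX.2 | exists x].
have Xb x : X x <= b.
  rewrite /b -lerBlDr; apply: lb_le_inf; first exact: hX.1.
  by move=> _ [y _ <-]; rewrite lerBlDr -lerBlDl Xc.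
have ab : a < b by rewrite /b ltrDl.
have bac : b - a = c by rewrite /b addrC addKr.
pose m := \int[P]_x X x.
have iX : P.-integrable setT (EFin \o X) by exact: integrable_bounded XM.
have am : a <= m.
  rewrite -[a](Rintegral_cst1 P).
  by apply: (@Rintegral_le _ _ _ _ _ _ `|a| M).
have mb : m <= b.
  rewrite -[b](Rintegral_cst1 P).
  by apply: (@Rintegral_le _ _ _ _ _ _ M `|b|).
pose u := (expR (l * b) - expR (l * a)) / c.
pose v := (b * expR (l * a) - a * expR (l * b)) / c.
have chordE x : (b - x) / (b - a) * expR (l * a) + (x - a) / (b - a) * expR (l * b)
    = u * x + v.
  by rewrite bac /u /v; field; rewrite gt_eqF.
have iuX : P.-integrable setT (EFin \o (fun x => u * X x)).
  apply: (@integrable_bounded _ _ _ _ _ (`|u| * M)).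
    exact: measurable_funM.
  by move=> x; rewrite normrM ler_wpM2l.
have icst (r : R) : P.-integrable setT (EFin \o (fun _ : T => r)).
  exact: (@integrable_bounded _ _ _ _ _ `|r|).
have step1 : \int[P]_x expR (l * X x) <= u * m + v.
  rewrite /m -RintegralZl// -[v](Rintegral_cst1 P) -RintegralD//.
  apply: le_Rintegral => //.
  - apply: (@integrable_bounded _ _ _ _ _ (expR (`|l| * M))).
      exact: measurable_expRM.
    by move=> x; exact: norm_expR_le.
  - apply: (@integrable_bounded _ _ _ _ _ (`|u| * M + `|v|)).
      by apply: measurable_funD => //; exact: measurable_funM.
    by move=> x; rewrite (le_trans (ler_normD _ _))// lerD2r normrM ler_wpM2l.
  - by move=> x _; rewrite -chordE; apply: expR_chord => //; rewrite aX Xb.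
apply: (le_trans step1); rewrite -chordE.
(* The mass at [b] of the law on [a] and [b] with mean [m]. *)
pose p := (m - a) / c.
have p01 : 0 <= p <= 1.
  apply/andP; split; first by apply: divr_ge0; [rewrite subr_ge0 | exact: ltW].
  by rewrite /p ler_pdivrMr// mul1r -bac lerD2r.
have := @bernoulli_mgf_le R p (l * c) p01.
rewrite -(ler_pM2l (expR_gt0 (l * a))) -expRD => /le_trans H.
have -> : l * m + l ^+ 2 * c ^+ 2 / 8 = l * a + (p * (l * c) + (l * c) ^+ 2 / 8).
  by rewrite /p; field; rewrite gt_eqF.
apply: le_trans (H _ (lexx _)).
have -> : l * b = l * a + l * c by rewrite /b mulrDr.
rewrite expRD bac le_eqVlt; apply/orP; left; apply/eqP.
by rewrite /p /b; field; rewrite gt_eqF.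
Qed.

End hoeffding.

(** * Product measures and McDiarmid's inequality *)

Section bounded_fubini.
Context {d1 d2} {T1 : measurableType d1} {T2 : measurableType d2} {R : realType}.
Variables (P1 : probability T1 R) (P2 : probability T2 R).
Variables (f : T1 * T2 -> R) (M : R).
Hypotheses (mf : measurable_fun setT f) (fM : forall z, `|f z| <= M).

Let mfx (x : T1) : measurable_fun setT (fun y => f (x, y)).
Proof. by apply: measurableT_comp => //; exact: pair1_measurable. Qed.

Let FE : (fun x => (\int[P2]_y f (x, y))%:E) = fubini_F P2 (EFin \o f).
Proof. by apply/funext => x; apply: EFin_Rintegral. Qed.

Lemma measurable_Rintegral_section :
  measurable_fun setT (fun x => \int[P2]_y f (x, y)).
Proof.
apply/measurable_EFinP; rewrite /comp FE.
apply: (@measurable_fubini_F _ _ _ _ _ P1 P2).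
exact: (@integrable_bounded _ _ _ (P1 \x P2)%E f M).
Qed.

Lemma Rintegral_prod :
  \int[(P1 \x P2)%E]_z f z = \int[P1]_x \int[P2]_y f (x, y).
Proof.
rewrite [LHS]/Rintegral -integral12_prod_meas1; last first.
  exact: (@integrable_bounded _ _ _ (P1 \x P2)%E f M).
by rewrite -FE.
Qed.

End bounded_fubini.

Section power.
Context {d} {T : measurableType d} {R : realType} (D : probability T R).

Definition tcons {n} (p : T * n.-tuple T) : n.+1.-tuple T := [tuple of p.1 :: p.2].

Lemma measurable_tcons n : measurable_fun setT (@tcons n).
Proof. exact: measurable_cons. Qed.

HB.instance Definition _ n :=
  isMeasurableFun.Build _ _ _ _ (@tcons n) (@measurable_tcons n).

(** The [n]-fold product of [D], built by recursion so that inductions can split off the first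
    coordinate. *)
Fixpoint power_prob n : probability (n.-tuple T) R :=
  match n with
  | 0 => \d_ [tuple]
  | n'.+1 => distribution (D \x power_prob n')%E (@tcons n')
  end.

Lemma Rintegral_powerS n (f : n.+1.-tuple T -> R) M :
  measurable_fun setT f -> (forall t, `|f t| <= M) ->
  \int[power_prob n.+1]_t f t =
  \int[D]_x \int[power_prob n]_t f (tcons (x, t)).
Proof.
move=> mf fM; have mfc : measurable_fun setT (f \o @tcons n).
  by apply: measurableT_comp => //; exact: measurable_tcons.
rewrite -(@Rintegral_prod _ _ _ _ _ D (power_prob n) (f \o @tcons n) M)//;
  last first.
  by move=> z; exact: fM.
rewrite [LHS]/Rintegral integral_distribution//; first exact/measurable_EFinP.
apply: (@integrable_bounded _ _ _ (D \x power_prob n)%E (f \o @tcons n) M) => //.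
by move=> z; exact: fM.
Qed.

Lemma Rintegral_power0 (f : 0.-tuple T -> R) :
  \int[power_prob 0]_t f t = f [tuple].
Proof.
have -> : f = cst (f [tuple]) by apply/funext => t; rewrite tuple0.
by rewrite Rintegral_cst1.
Qed.

(** The one-sided inequality bounds the absolute difference too, since [t] and [t'] can be
    exchanged. *)
Definition bounded_differences {n} (f : n.-tuple T -> R) (c : R) :=
  forall (i : 'I_n) (t t' : n.-tuple T),
    (forall j, j != i -> tnth t j = tnth t' j) -> f t - f t' <= c.

(** Induction on [n]: for a fixed first coordinate the induction hypothesis handles the others, and
    Hoeffding's lemma then applies to the partial mean [F], whose oscillation is again at most [c].
    Each coordinate costs one factor [expR (l ^+ 2 * c ^+ 2 / 8)]. *)
Lemma mcdiarmid_mgf n (f : n.-tuple T -> R) (M c : R) :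
  measurable_fun setT f -> (forall t, `|f t| <= M) ->
  bounded_differences f c -> forall l : R,
  \int[power_prob n]_t expR (l * f t) <=
  expR (l * \int[power_prob n]_t f t + n%:R * (l ^+ 2 * c ^+ 2 / 8)).
Proof.
move=> + + + l; elim: n f => [|n IH] f mf fM fc.
  by rewrite !Rintegral_power0 mul0r addr0.
have mfc : measurable_fun setT (f \o @tcons n).
  by apply: measurableT_comp => //; exact: measurable_tcons.
have mfx x : measurable_fun setT (fun t => f (tcons (x, t))).
  by apply: measurableT_comp mfc _; exact: pair1_measurable.
pose F x := \int[power_prob n]_t f (tcons (x, t)).
have mF : measurable_fun setT F.
  by apply: (@measurable_Rintegral_section _ _ _ _ _ D (power_prob n)
    (f \o @tcons n) M) => // z; exact: fM.
have FM x : `|F x| <= M by exact: normr_Rintegral_le.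
have Fc x y : F x - F y <= c.
  rewrite /F -RintegralB//; try exact: (@integrable_bounded _ _ _ _ _ M).
  rewrite -[c](Rintegral_cst1 (power_prob n)).
  apply: (@Rintegral_le _ _ _ _ _ _ (M + M) `|c|) => //.
  - exact: measurable_funB.
  - by move=> t; rewrite (le_trans (ler_normB _ _))// lerD.
  (* The two tuples differ only in their first coordinate. *)
  - move=> t; apply: (fc ord0) => j j0.
    have [k ->] : exists k, j = lift ord0 k.
      by case: (unliftP ord0 j) j0 => [k -> _|-> /eqP//]; exists k.
    by rewrite !tnthS.
pose e := expR (n%:R * (l ^+ 2 * c ^+ 2 / 8)).
have mE : measurable_fun setT (fun x => expR (l * F x)) by exact: measurable_expRM.
have mf' : measurable_fun setT (fun t => expR (l * f t)) by exact: measurable_expRM.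
have EM x : `|expR (l * F x)| <= expR (`|l| * M) by exact: norm_expR_le.
have fM' t : `|expR (l * f t)| <= expR (`|l| * M) by exact: norm_expR_le.
rewrite (@Rintegral_powerS _ f M)//.
rewrite (@Rintegral_powerS _ (fun t => expR (l * f t)) (expR (`|l| * M)))//.
apply: (@le_trans _ _ (\int[D]_x (e * expR (l * F x)))).
  apply: (@Rintegral_le _ _ _ _ _ _ (expR (`|l| * M)) (e * expR (`|l| * M))).
  - apply: (@measurable_Rintegral_section _ _ _ _ _ D (power_prob n)
      (fun z => expR (l * f (tcons z))) (expR (`|l| * M))) => //.
    exact: measurable_expRM.
  - exact: measurable_funM.
  - move=> x; apply: normr_Rintegral_le => //; exact: measurable_expRM.
  - by move=> x; rewrite normrM ger0_norm ?expR_ge0// ler_wpM2l ?expR_ge0.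
  - move=> x; rewrite /e -expRD addrC; apply: IH => //.
    move=> i t t' tt'; apply: (fc (lift ord0 i)) => j.
    case: (unliftP ord0 j) => [k ->|->]; last by rewrite !tnth0.
    by rewrite (inj_eq lift_inj) => ki; rewrite !tnthS; exact: tt'.
rewrite RintegralZl//; last exact: (@integrable_bounded _ _ _ _ _ (expR (`|l| * M))).
have -> : l * \int[D]_x F x + n.+1%:R * (l ^+ 2 * c ^+ 2 / 8) =
    n%:R * (l ^+ 2 * c ^+ 2 / 8) + (l * \int[D]_x F x + l ^+ 2 * c ^+ 2 / 8).
  by rewrite -[n.+1]addn1 natrD; ring.
rewrite expRD ler_wpM2l ?expR_ge0//; exact: (@hoeffding_lemma _ _ _ _ _ M).
Qed.

End power.

(** * Joint law of an i.i.d. sample *)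

Section iid_law.
Context {d} {T : measurableType d} {R : realType} (D : probability T R).

Definition box {n} (B : 'I_n -> set T) : set (n.-tuple T) :=
  [set t | forall i, B i (tnth t i)].

Definition boxes n : set (set (n.-tuple T)) :=
  [set A | exists2 B : 'I_n -> set T, (forall i, measurable (B i)) & A = box B].

Lemma measurable_box n (B : 'I_n -> set T) :
  (forall i, measurable (B i)) -> measurable (box B).
Proof.
move=> mB; have -> : box B = \bigcap_(i in [set: 'I_n]) ((@tnth n T ^~ i) @^-1` B i).
  by apply/seteqP; split=> [t Bt i _|t Bt i]; [exact: Bt | exact: (Bt i I)].
apply: fin_bigcap_measurable => // i _.
by rewrite -[X in measurable X]setTI; exact: measurable_tnth.
Qed.

Lemma boxT n : box (fun _ : 'I_n => setT) = setT.
Proof. by apply/seteqP; split. Qed.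

(** The generators of the product sigma-algebra are coordinate preimages, that is, boxes all of
    whose sides but one are the full space. *)
Lemma measurable_tupleE n :
  (measurable : set (set (n.-tuple T))) = <<s boxes n >>.
Proof.
apply/seteqP; split; last first.
  apply: smallest_sub; first exact: sigma_algebra_measurable.
  by move=> _ [B mB ->]; exact: measurable_box.
apply: smallest_sub; first exact: smallest_sigma_algebra.
move=> A; rewrite -bigcup_seq => -[i _ [C mC <-]].
apply: sub_sigma_algebra.
exists (fun j => if j == i then C else setT).
  by move=> j; case: ifPn.
rewrite setTI; apply/seteqP; split=> [t Ct j|t Bt] /=.
  by case: eqP => // ->.
by have := Bt i; rewrite eqxx.
Qed.

Lemma setI_closed_boxes n : setI_closed (boxes n).
Proof.
move=> _ _ [B mB ->] [C mC ->]; exists (fun i => B i `&` C i).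
  by move=> i; exact: measurableI.
by apply/seteqP; split=> [t [Bt Ct] i|t BCt]; split => // i; have [] := BCt i.
Qed.

Lemma power_prob_box n (B : 'I_n -> set T) : (forall i, measurable (B i)) ->
  power_prob D n (box B) = (\prod_(i < n) D (B i))%E.
Proof.
elim: n B => [|n IH] B mB.
  rewrite big_ord0 (_ : box B = setT) ?probability_setT//.
  by apply/seteqP; split=> // t _ [].
rewrite big_ord_recl /= /distribution /pushforward.
rewrite (_ : _ @^-1` _ = B ord0 `*` box (fun i => B (lift ord0 i))).
  rewrite product_measure1E//; last exact: measurable_box.
  by rewrite [X in (_ * X)%E]IH.
apply/seteqP; split=> [[x t] Bxt|[x t] [Bx Bt] i] /=.
  split=> /=; first by have := Bxt ord0; rewrite tnth0.
  by move=> i; have := Bxt (lift ord0 i); rewrite tnthS.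
by case: (unliftP ord0 i) => [j ->|->]; rewrite ?tnthS ?tnth0.
Qed.

Context {dO} {Omega : measurableType dO} {Pr : probability Omega R}.

Definition sample {n} (Z : 'I_n -> {RV Pr >-> T}) (w : Omega) : n.-tuple T :=
  [tuple Z i w | i < n].

Lemma measurable_sample {n} (Z : 'I_n -> {RV Pr >-> T}) :
  measurable_fun setT (sample Z).
Proof.
apply/measurable_fun_tnthP => i.
rewrite (_ : _ \o _ = Z i); first exact: measurable_funPT.
by apply/funext => w /=; rewrite tnth_mktuple.
Qed.

HB.instance Definition _ n (Z : 'I_n -> {RV Pr >-> T}) :=
  isMeasurableFun.Build _ _ _ _ (sample Z) (measurable_sample Z).

(** Independence and the common law give the same product value on every box; boxes are stable under
    intersection and generate the sigma-algebra, so the two measures coincide. *)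
Lemma distribution_sample n (Z : 'I_n -> {RV Pr >-> T}) : iid D Z ->
  forall A, measurable A -> distribution Pr (sample Z) A = power_prob D n A.
Proof.
move=> [indep law]; apply: (measure_unique (boxes n) (fun=> setT)).
- exact: measurable_tupleE.
- exact: setI_closed_boxes.
- by move=> _; exists (fun=> setT); [|rewrite boxT].
- exact: bigcup_const.
- move=> _ [B mB ->].
  transitivity (\prod_(i < n) D (B i))%E; last exact/esym/power_prob_box.
  have := indep [set: 'I_n]%SET B (fun i _ => mB i).
  rewrite (_ : \bigcap_(i in _) _ = sample Z @^-1` box B); last first.
    apply/seteqP; split=> [w Bw i|w Bw i _] /=.
      by rewrite tnth_mktuple; apply: Bw; rewrite /= inE.
    by have := Bw i; rewrite tnth_mktuple.
  move=> H; rewrite [LHS]H; apply: eq_big => [i|i _]; first by rewrite inE.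
  exact: law.
- move=> _; exact: (le_lt_trans (probability_le1 _ _) (ltry 1)).
Qed.

Lemma ge0_integral_sample n (Z : 'I_n -> {RV Pr >-> T}) (f : n.-tuple T -> \bar R) :
  iid D Z -> measurable_fun setT f -> (forall t, 0 <= f t)%E ->
  (\int[Pr]_w f (sample Z w) = \int[power_prob D n]_t f t)%E.
Proof.
move=> iidZ mf f0.
rewrite -(ge0_integral_distribution (sample Z))//.
apply: eq_measure_integral => A mA _; exact: distribution_sample.
Qed.

End iid_law.

(** * Exponential moments of the square of a sub-Gaussian variable *)

Section gaussian_mixture.
Context {R : realType}.
Local Notation mu := (@lebesgue_measure R).

(** Completing the square: an exponential tilt shifts the mean of a Gaussian to [a * x]. *)
Lemma normal_pdf_mgf (a x g : R) :
  expR (a * g * x) * normal_pdf 0 1 g =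
  expR (a ^+ 2 * x ^+ 2 / 2) * normal_pdf (a * x) 1 g.
Proof.
rewrite !normal_pdfE ?oner_eq0// /normal_fun.
rewrite !(mulrCA (expR _)) -!expRD; congr (_ * expR _).
by rewrite expr1n; field.
Qed.

(** The quadratic tilt turns the standard Gaussian into one of variance [(1 - k)^-1], up to the
    change of normalization. *)
Lemma normal_pdf_rescale (k g : R) : k < 1 ->
  expR (k * g ^+ 2 / 2) * normal_pdf 0 1 g =
  (Num.sqrt (1 - k))^-1 * normal_pdf 0 (Num.sqrt (1 - k))^-1 g.
Proof.
move=> k1; have k0 : 0 < 1 - k by rewrite subr_gt0.
set s := Num.sqrt _; have s0 : 0 < s by rewrite sqrtr_gt0.
have sk : s ^+ 2 = 1 - k by rewrite sqr_sqrtr// ltW.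
have kE : k = 1 - s ^+ 2 by rewrite sk subKr.
have sn0 : s != 0 by rewrite gt_eqF.
rewrite !normal_pdfE ?oner_eq0 ?invr_eq0// /normal_fun.
rewrite mulrCA -expRD mulrA; congr (_ * expR _); last by rewrite kE; field.
rewrite /normal_peak expr1n mul1r exprVn -mulrnAr sqrtrM ?invr_ge0 ?sqr_ge0//.
rewrite sqrtrV ?sqr_ge0// sqrtr_sqr gtr0_norm// invfM invrK mulrA mulVf// mul1r.
by [].
Qed.

Context {d} {T : measurableType d} (P : probability T R).

(** Since [expR (c * X ^+ 2)] is the mean of [expR (a * g * X)] over a standard Gaussian [g], with
    [a ^+ 2 = 2 * c], Tonelli's theorem lets the hypothesis be used at [l = a * g]. What remains is
    the Gaussian mean of [expR (c * v * g ^+ 2)]. *)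
Lemma subgaussian_sq_mgf (X : T -> R) (v c : R) :
  measurable_fun setT X -> 0 <= c -> 2 * c * v < 1 ->
  (forall l : R, (\int[P]_x (expR (l * X x))%:E <=
                  (expR (l ^+ 2 * v / 2))%:E)%E) ->
  (\int[P]_x (expR (c * X x ^+ 2))%:E <= ((Num.sqrt (1 - 2 * c * v))^-1)%:E)%E.
Proof.
move=> mX c0 cv1 XP; pose a := Num.sqrt (2 * c).
have a2 : a ^+ 2 = 2 * c by rewrite sqr_sqrtr// mulr_ge0.
pose f (z : T * R) := (expR (a * z.2 * X z.1) * normal_pdf 0 1 z.2)%:E.
have mf : measurable_fun setT f.
  apply/measurable_EFinP; apply: measurable_funM.
    apply: measurableT_comp => //; apply: measurable_funM.
      by apply: measurable_funM.
    exact: measurableT_comp.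
  apply: measurableT_comp => //; exact: measurable_normal_pdf.
have f0 z : (0 <= f z)%E.
  by rewrite lee_fin mulr_ge0 ?expR_ge0 ?normal_pdf_ge0.
rewrite [leLHS](_ : _ = \int[P]_x \int[mu]_g f (x, g))%E; last first.
  apply: eq_integral => x _; rewrite /f /=.
  under eq_integral do rewrite normal_pdf_mgf EFinM.
  rewrite ge0_integralZl_EFin ?expR_ge0//.
  - rewrite integral_normal_pdf ?oner_eq0// mule1; congr (expR _)%:E.
    by rewrite a2; field.
  - by move=> g _; rewrite lee_fin normal_pdf_ge0.
  - by apply/measurable_EFinP; exact: measurable_normal_pdf.
rewrite fubini_tonelli//.
pose s := (Num.sqrt (1 - 2 * c * v))^-1.
have s0 : 0 <= s by rewrite invr_ge0.
have sn0 : s != 0 by rewrite /s invr_eq0 gt_eqF// sqrtr_gt0 subr_gt0.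
apply: (@le_trans _ _ (\int[mu]_g (s * normal_pdf 0 s g)%:E)%E); last first.
  under eq_integral do rewrite EFinM.
  rewrite ge0_integralZl_EFin//.
  - by rewrite integral_normal_pdf// mule1.
  - by move=> g _; rewrite lee_fin normal_pdf_ge0.
  - by apply/measurable_EFinP; exact: measurable_normal_pdf.
apply: ge0_le_integral => //.
- by move=> g _; exact: integral_ge0.
- exact: (measurable_fun_fubini_tonelli_G f).
- apply/measurable_EFinP; apply: measurable_funM => //.
  exact: measurable_normal_pdf.
- move=> g _; rewrite -normal_pdf_rescale// /f /=.
  under eq_integral do rewrite EFinM.
  rewrite ge0_integralZr//; last 2 first.
  + by apply/measurable_EFinP; exact: measurable_expRM.
  + by rewrite lee_fin normal_pdf_ge0.
  rewrite EFinM lee_wpmul2r ?lee_fin ?normal_pdf_ge0//.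
  apply: (le_trans (XP _)); rewrite lee_fin ler_expR exprMn a2.
  by rewrite le_eqVlt; apply/orP; left; apply/eqP; ring.
Qed.

End gaussian_mixture.

(** * The Donsker-Varadhan inequality *)

Section donsker_varadhan.
Local Open Scope charge_scope.
Context {d} {T : measurableType d} {R : realType} (Q P : probability T R).

(** The integrals may be infinite, so positive and negative parts are compared separately. *)
Lemma ae_le_integral (f g : T -> \bar R) :
  measurable_fun setT f -> measurable_fun setT g ->
  {ae Q, forall t, (f t <= g t)%E} -> (\int[Q]_t f t <= \int[Q]_t g t)%E.
Proof.
move=> mf mg fg; rewrite integralE [leRHS]integralE; apply: leeB.
  apply: ae_ge0_le_integral => //; try exact: measurable_funepos.
  by apply: filterS fg => t fgt _; rewrite !funeposE ge_max !le_max fgt lexx orbT.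
apply: ae_ge0_le_integral => //; try exact: measurable_funeneg.
apply: filterS fg => t fgt _.
by rewrite !funenegE ge_max !le_max leeN2 fgt lexx orbT.
Qed.

Hypothesis QP : Q `<< P.

Let rn := 'd (charge_of_finite_measure Q) '/d P.
Let r t := fine (rn t).

Let rnE t : rn t = (r t)%:E.
Proof. by rewrite /r fineK//; exact: Radon_Nikodym_fin_num. Qed.

Let mrn : measurable_fun setT rn.
Proof. exact: measurable_int (Radon_Nikodym_integrable _). Qed.

Let mr : measurable_fun setT r.
Proof. exact: measurableT_comp. Qed.

Let mlne : measurable_fun setT (fun t => lne (rn t)).
Proof.
rewrite (_ : (fun t => _) = (fun t => if r t <= 0 then -oo%E else (ln (r t))%:E)).
  apply: measurable_fun_ifT => //; first exact: measurable_fun_ler.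
  by apply/measurable_EFinP; exact: measurableT_comp.
by apply/funext => t; rewrite rnE.
Qed.

(** The [Q]-mass of the set where [r] is nonpositive is the integral of [r] over it, hence at most
    0. *)
Let rn_gt0 : {ae Q, forall t, 0 < r t}.
Proof.
have mN : measurable [set t | r t <= 0].
  rewrite (_ : [set t | _] = r @^-1` `]-oo, 0]).
    by rewrite -[X in measurable X]setTI; apply: mr => //; exact: measurable_itv.
  by apply/seteqP; split=> t /=; rewrite in_itv.
exists [set t | r t <= 0]; split => //; last first.
  by move=> t /= /negP; rewrite -leNgt.
apply/eqP; rewrite eq_le measure_ge0 andbT.
have /= := @Radon_Nikodym_integral _ _ _ (charge_of_finite_measure Q) P _ QP mN.
move=> ->; rewrite integralE (eq_integral (cst 0)%E); last first.
  by apply: le0_funeposE => t /= rt0; rewrite -/rn rnE lee_fin.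
by rewrite integral0 sub0e oppe_le0; apply: integral_ge0.
Qed.

(* [expR (- ln (r t))] is [(r t)^-1] in a form whose measurability is immediate. *)
Lemma integral_div_Radon_Nikodym_le (g : T -> R) : measurable_fun setT g ->
  (forall t, 0 <= g t) ->
  (\int[Q]_t ((if 0 < r t then g t * expR (- ln (r t)) else 0)%:E) <=
   \int[P]_t (g t)%:E)%E.
Proof.
move=> mg g0; set u := fun t => if 0 < r t then g t * expR (- ln (r t)) else 0.
have mu : measurable_fun setT (EFin \o u).
  apply/measurable_EFinP; apply: measurable_fun_ifT => //.
    exact: measurable_fun_ltr.
  by apply: measurable_funM => //; do 3 apply: measurableT_comp => //.
have u0 t : (0 <= (EFin \o u) t)%E.
  by rewrite lee_fin /u; case: ifPn => // _; rewrite mulr_ge0 ?expR_ge0.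
rewrite -(Radon_Nikodym_SigmaFinite.change_of_variables QP u0 _ mu)//.
apply: ae_ge0_le_integral => //.
- move=> t _; rewrite mule_ge0//; exact: Radon_Nikodym_SigmaFinite.f_ge0.
- apply: emeasurable_funM => //.
  exact: measurable_int (Radon_Nikodym_SigmaFinite.f_integrable _).
- by move=> t _; rewrite lee_fin.
- exact/measurable_EFinP.
(* The change of variables uses another version of the derivative, equal to [rn] almost everywhere.
   The product with [rn] is then [g] where [r] is positive and 0 elsewhere. *)
have := ae_eq_Radon_Nikodym_SigmaFinite QP measurableT.
apply: filterS => t /(_ I) -> _; rewrite -/rn rnE -EFinM lee_fin /u.
by case: ifPn => [rt|_]; rewrite ?mul0r// expRN lnK ?posrE// divfK ?gt_eqF.
Qed.

(** Apply [1 + x <= expR x] to [x = f - ln r]: [Q]-almost surely [f + 1 - u <= ln r], where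
    [u = expR f / r] has [Q]-integral at most that of [expR f] under [P], which is 1. *)
Lemma integral_le_KL_ac (f : T -> R) (M : R) : measurable_fun setT f ->
  (forall t, `|f t| <= M) -> \int[P]_t expR (f t) = 1 ->
  ((\int[Q]_t f t)%:E <= \int[Q]_t lne (rn t))%E.
Proof.
move=> mf fM Pf1; pose u t := if 0 < r t then expR (f t) * expR (- ln (r t)) else 0.
have mef : measurable_fun setT (fun t => expR (f t)) by exact: measurableT_comp.
have efM t : `|expR (f t)| <= expR M.
  rewrite ger0_norm ?expR_ge0// ler_expR.
  exact: le_trans (ler_norm _) (fM t).
have u0 t : 0 <= u t.
  by rewrite /u; case: ifPn => // _; rewrite mulr_ge0 ?expR_ge0.
have mu : measurable_fun setT u.
  apply: measurable_fun_ifT => //; first exact: measurable_fun_ltr.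
  by apply: measurable_funM => //; do 3 apply: measurableT_comp => //.
have u1 : (\int[Q]_t (u t)%:E <= 1)%E.
  have := integral_div_Radon_Nikodym_le _ mef (fun t => expR_ge0 (f t)).
  by rewrite -(EFin_Rintegral P _ _ mef efM) Pf1.
have iu : Q.-integrable setT (EFin \o u).
  apply/integrableP; split; first exact/measurable_EFinP.
  under eq_integral do rewrite /= ger0_norm//.
  exact: le_lt_trans u1 (ltry _).
pose k t := f t + (1 - u t).
have i1 : Q.-integrable setT (EFin \o (fun _ : T => 1 : R)).
  by apply: (@integrable_bounded _ _ _ _ _ `|1|).
have i1u : Q.-integrable setT (EFin \o (fun t => 1 - u t)).
  have := integrableB measurableT i1 iu; apply: eq_integrable => //.
have i_f : Q.-integrable setT (EFin \o f) by exact: integrable_bounded fM.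
apply: (@le_trans _ _ (\int[Q]_t (k t)%:E)%E).
  under eq_integral do rewrite EFinD.
  rewrite integralD// -(EFin_Rintegral Q _ _ mf fM) leeDl//.
  under eq_integral do rewrite EFinB.
  rewrite integralB// -[X in (X - _)%E](EFin_Rintegral Q (fun=> 1) 1)//; last first.
    by move=> _; rewrite normr1.
  by rewrite Rintegral_cst1 subre_ge0.
apply: ae_le_integral => //.
  apply/measurable_EFinP; apply: measurable_funD => //; exact: measurable_funB.
apply: filterS rn_gt0 => t rt; rewrite rnE lne_EFin// lee_fin /k /u rt.
rewrite -expRD.
by have := expR_ge1Dx (f t - ln (r t)); lra.
Qed.

End donsker_varadhan.

(** Subtracting [ln Z] from [f] normalizes [expR f] to a density with respect to [P], the case
    already settled; without absolute continuity the right side is infinite. *)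
Lemma donsker_varadhan {d} {T : measurableType d} {R : realType}
    (Q P : probability T R) (f : T -> R) (M : R) :
  measurable_fun setT f -> (forall t, `|f t| <= M) ->
  ((\int[Q]_t f t)%:E <= KL Q P + (ln (\int[P]_t expR (f t)))%:E)%E.
Proof.
move=> mf fM; rewrite /KL; case: asboolP => [QP|_]; last by rewrite addye// leey.
set Z := \int[P]_t expR (f t).
have mef : measurable_fun setT (fun t => expR (f t)) by exact: measurableT_comp.
have efM t : `|expR (f t)| <= expR M.
  rewrite ger0_norm ?expR_ge0// ler_expR.
  exact: le_trans (ler_norm _) (fM t).
have Z0 : 0 < Z.
  apply: (@lt_le_trans _ _ (expR (- M))); first exact: expR_gt0.
  rewrite -[leLHS](Rintegral_cst1 P).
  apply: (@Rintegral_le _ _ _ _ _ _ `|expR (- M)| (expR M)) => //.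
  by move=> t; rewrite ler_expR; have := fM t; rewrite ler_norml => /andP[].
pose g t := f t - ln Z.
have mg : measurable_fun setT g by exact: measurable_funB.
have gM t : `|g t| <= M + `|ln Z|.
  by rewrite (le_trans (ler_normB _ _))// lerD2r.
have Pg : \int[P]_t expR (g t) = 1.
  under eq_Rintegral do rewrite /g expRB lnK ?posrE//.
  rewrite RintegralZr//; last exact: integrable_bounded efM.
  by rewrite -/Z divff// gt_eqF.
have := @integral_le_KL_ac _ _ _ _ _ QP g _ mg gM Pg.
rewrite /g RintegralB//; last 2 first.
- exact: integrable_bounded fM.
- exact: (@integrable_bounded _ _ _ _ _ `|ln Z|).
by rewrite Rintegral_cst1 EFinB leeBlDr.
Qed.

(** * Measurability of the calibrated efficiency *)

Section measurability.
Context {d} {T : measurableType d} {R : realType}.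

(** Trades sorting for counting, the form from which measurability can be read off. *)
Lemma kth_smallest_le (xs : seq R) (k : nat) (a : R) : (k.-1 < size xs)%N ->
  (kth_smallest xs k <= a) = (k.-1 < count (<= a)%R xs)%N.
Proof.
move=> kxs; have sxs : sorted <=%R (sort <=%R xs) by exact: sort_le_sorted.
have -> : count (<= a) xs = count (<= a) (sort <=%R xs).
  by apply/esym; apply/permP; rewrite perm_sort.
rewrite /kth_smallest; case: ltnP => h; first exact: nth_count_le.
apply/negbTE; rewrite -ltNge; apply: nth_count_gt => //.
by rewrite h size_sort.
Qed.

Lemma measurable_kth_smallest n (f : 'I_n -> T -> R) (k : nat) :
  (forall i, measurable_fun setT (f i)) ->
  measurable_fun setT (fun t => kth_smallest [seq f i t | i <- enum 'I_n] k).
Proof.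
(* A rank beyond [n] yields the default value 0 of [nth], a constant. *)
move=> mf; have [kn|kn] := ltnP k.-1 n; last first.
  rewrite (_ : (fun t => _) = cst 0); first exact: measurable_cst.
  apply/funext => t; rewrite /kth_smallest nth_default//.
  by rewrite size_sort size_map size_enum_ord.
apply: (measurability _ (RGenOInfty.measurableE R)) => //.
move=> _ [_ [a ->] <-]; rewrite setTI.
rewrite -[X in measurable X]setCK; apply: measurableC.
(* The sublevel set is the finite union, over index sets [J] with more than [k.-1] elements, of the
   events that all values indexed by [J] are at most [a]. *)
pose B (J : {set 'I_n}) := \bigcap_(i in [set i | i \in J]) (f i @^-1` `]-oo, a]).
rewrite (_ : ~` _ = \bigcup_(J in [set J : {set 'I_n} | (k.-1 < #|J|)%N]) B J).
  apply: fin_bigcup_measurable => // J _; apply: fin_bigcap_measurable => // i _.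
  by rewrite -[X in measurable X]setTI; apply: mf => //; exact: measurable_itv.
have countE t : count (<= a)%R [seq f i t | i <- enum 'I_n] =
    #|[set i | f i t <= a]%SET|.
  rewrite count_map cardE enumT [in RHS]/enum_mem size_filter.
  by apply: eq_count => i; rewrite /= inE.
have sz t : size [seq f i t | i <- enum 'I_n] = n.
  by rewrite size_map size_enum_ord.
apply/seteqP; split=> t /=; rewrite in_itv/= andbT.
  move=> /negP; rewrite -leNgt kth_smallest_le ?sz// countE.
  by move=> h; exists [set i | f i t <= a]%SET => // i; rewrite /= inE in_itv.
move=> [J /= kJ BJ]; apply/negP; rewrite -leNgt.
rewrite kth_smallest_le ?sz// countE.
apply: (leq_trans kJ); apply: subset_leq_card; apply/fintype.subsetP => i iJ.
by rewrite inE; have := BJ i iJ; rewrite /= in_itv.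
Qed.

Lemma measurable_fun_countable_case (h : T -> int) (G : int -> T -> R) :
  (forall z, measurable [set t | h t = z]) ->
  (forall z, measurable_fun setT (G z)) ->
  measurable_fun setT (fun t => G (h t) t).
Proof.
move=> mh mG _ B mB; rewrite setTI.
rewrite (_ : _ @^-1` B = \bigcup_(z in [set: int])
    ([set t | h t = z] `&` (G z @^-1` B))); last first.
  apply/seteqP; split=> t /=; first by move=> Bt; exists (h t).
  by move=> [z _ [<-]].
apply: countable_bigcupT_measurable => // z; apply: measurableI => //.
by rewrite -[X in measurable X]setTI; exact: mG.
Qed.

(** Rounding [tau] down to multiples of [n.+1%:R^-1] leaves countably many thresholds, for which the
    composition is measurable piece by piece; the Lipschitz property makes these approximations
    converge pointwise. *)
Lemma measurable_fun_lipschitz_comp (F : R -> T -> R) (tau : T -> R) (L : R) :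
  (forall r, measurable_fun setT (F r)) ->
  (forall t r r', `|F r t - F r' t| <= L * `|r - r'|) ->
  measurable_fun setT tau -> measurable_fun setT (fun t => F (tau t) t).
Proof.
move=> mF LF mtau.
pose h (n : nat) (t : T) := Num.floor (n.+1%:R * tau t).
pose g (n : nat) (t : T) := F ((h n t)%:~R / n.+1%:R) t.
apply: (@measurable_fun_cvg _ _ _ _ g).
  move=> n; apply: (@measurable_fun_countable_case (h n)
    (fun z => F (z%:~R / n.+1%:R))) => // z.
  rewrite (_ : [set t | _] = (fun t => n.+1%:R * tau t) @^-1` `[z%:~R, (z + 1)%:~R[).
    rewrite -[X in measurable X]setTI.
    have : measurable_fun setT (fun t => n.+1%:R * tau t) by exact: measurable_funM.
    by apply => //; exact: measurable_itv.
  apply/seteqP; split=> t /=; rewrite in_itv/=; last by move=> /floor_def.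
  by move=> <-; exact: floor_itv.
move=> t _; apply/cvgrPdist_le => e e0.
have L0 : 0 <= `|L| by [].
near=> n.
rewrite (le_trans (LF _ _ _))// (le_trans (ler_wpM2r _ (ler_norm L)))//.
have n0 : (0 : R) < n.+1%:R by rewrite ltr0n.
have : `|tau t - (h n t)%:~R / n.+1%:R| <= n.+1%:R^-1.
  have /andP[h1 h2] := floor_itv (n.+1%:R * tau t).
  rewrite ger0_norm; last first.
    by rewrite subr_ge0 ler_pdivrMr// mulrC.
  rewrite -(ler_pM2l n0) mulrBr mulrCA divff ?gt_eqF// mulr1.
  by rewrite /h; move: h2; rewrite intrD; lra.
move=> H; rewrite (le_trans (ler_wpM2l L0 H))//.
rewrite ler_pdivrMr// -ler_pdivrMl//.
apply: (@le_trans _ _ n%:R); last by rewrite ler_nat.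
by near: n; exact: nbhs_infty_ger.
Unshelve. all: end_near.
Qed.

End measurability.

(** * Uniform deviation of the efficiency over the thresholds *)

Lemma measurable_bigmaxr {d} {T : measurableType d} {R : realType} (I : Type)
    (s : seq I) (x0 : T -> R) (h : I -> T -> R) :
  measurable_fun setT x0 -> (forall i, measurable_fun setT (h i)) ->
  measurable_fun setT (fun t => \big[Num.max/x0 t]_(i <- s) h i t).
Proof.
move=> mx0 mh; elim: s => [|i s IH].
  by under eq_fun do rewrite big_nil.
under eq_fun do rewrite big_cons.
exact: measurable_maxr.
Qed.

Lemma Rintegral_power_tnth {d} {T : measurableType d} {R : realType}
    (D : probability T R) n (i : 'I_n) (g : T -> R) (M : R) :
  measurable_fun setT g -> (forall x, `|g x| <= M) ->
  \int[power_prob D n]_t g (tnth t i) = \int[D]_x g x.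
Proof.
move=> mg gM; elim: n i => [[]//|n IH] i.
rewrite (@Rintegral_powerS _ _ _ D n (fun t => g (tnth t i)) M)//; last first.
  by apply: measurableT_comp => //; exact: measurable_tnth.
case: (unliftP ord0 i) => [j ->|->].
  under eq_Rintegral do under eq_Rintegral do rewrite tnthS.
  by under eq_Rintegral do rewrite IH; rewrite Rintegral_cst1.
under eq_Rintegral do under eq_Rintegral do rewrite tnth0.
by under eq_Rintegral do rewrite /= Rintegral_cst1.
Qed.

Section deviation.
Context {d dT} {T : measurableType d} {Theta : measurableType dT} {R : realType}.
Variables (D : probability T R) (P : probability Theta R) (N : nat).
Hypothesis N_gt0 : (0 < N)%N.
Variables (f : R -> Theta -> T -> R) (L : R).
Hypothesis mf : forall r, measurable_fun setT (fun q : Theta * T => f r q.1 q.2).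
Hypothesis f01 : forall r th p, 0 <= f r th p <= 1.
Hypothesis fL : forall r r' th p, `|f r th p - f r' th p| <= L * `|r - r'|.

Let f_le1 r th p : `|f r th p| <= 1.
Proof. by have /andP[f0 f1] := f01 r th p; rewrite ger0_norm. Qed.

Let mfth r th : measurable_fun setT (f r th).
Proof.
exact: (measurableT_comp (mf r) (pair1_measurable th)).
Qed.

Definition deviation (r : R) (th : Theta) (z : N.-tuple T) : R :=
  \int[D]_p f r th p - N%:R^-1 * \sum_(i < N) f r th (tnth z i).

Let N0 : (0 : R) < N%:R. Proof. by rewrite ltr0n. Qed.

Let mean_sum_const (c : R) : N%:R^-1 * \sum_(i < N) c = c.
Proof.
by rewrite sumr_const card_ord -[c *+ N]mulr_natl mulrA mulVf ?mul1r// gt_eqF.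
Qed.

(** The factor 2 counts the expectation and the empirical mean once each. *)
Lemma deviation_lipschitz r r' th z :
  `|deviation r th z - deviation r' th z| <= 2 * L * `|r - r'|.
Proof.
have -> : deviation r th z - deviation r' th z =
    \int[D]_p (f r th p - f r' th p) -
    N%:R^-1 * \sum_(i < N) (f r th (tnth z i) - f r' th (tnth z i)).
  rewrite RintegralB//; try exact: (@integrable_bounded _ _ _ _ _ 1).
  by rewrite sumrB /deviation; ring.
have Lr : `|f r th (tnth z (Ordinal N_gt0)) - f r' th (tnth z (Ordinal N_gt0))|
    <= L * `|r - r'| by [].
have Lr0 : 0 <= L * `|r - r'| by exact: le_trans Lr.
apply: (le_trans (ler_normB _ _)); rewrite -mulrA mulr_natl mulr2n; apply: lerD.
  apply: normr_Rintegral_le; last by move=> p; exact: fL.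
  exact: measurable_funB.
rewrite normrM ger0_norm ?invr_ge0// ler_pdivrMl//.
rewrite (le_trans (ler_norm_sum _ _ _))//.
rewrite (@le_trans _ _ (\sum_(i < N) L * `|r - r'|))//; first exact: ler_sum.
by rewrite sumr_const card_ord mulr_natl.
Qed.

Lemma deviation_le1 r th z : `|deviation r th z| <= 1.
Proof.
have m1 : \int[D]_p f r th p <= 1.
  by rewrite (le_trans (ler_norm _))//; exact: normr_Rintegral_le.
have m0 : 0 <= \int[D]_p f r th p.
  by apply: Rintegral_ge0 => p _; have /andP[] := f01 r th p.
have s0 : 0 <= N%:R^-1 * \sum_(i < N) f r th (tnth z i).
  rewrite mulr_ge0 ?invr_ge0//; apply: sumr_ge0 => i _.
  by have /andP[] := f01 r th (tnth z i).
have s1 : N%:R^-1 * \sum_(i < N) f r th (tnth z i) <= 1.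
  rewrite -[leRHS]mean_sum_const ler_pM2l ?invr_gt0//; apply: ler_sum => i _.
  by have /andP[] := f01 r th (tnth z i).
by rewrite /deviation ler_norml; apply/andP; split; lra.
Qed.

Lemma measurable_deviation r :
  measurable_fun setT (fun q : Theta * N.-tuple T => deviation r q.1 q.2).
Proof.
apply: measurable_funB.
  apply: (@measurableT_comp _ _ _ _ _ _ (fun th => \int[D]_p f r th p)) => //.
  exact: (@measurable_Rintegral_section _ _ _ _ _ P D
    (fun q => f r q.1 q.2) 1).
apply: measurable_funM => //; apply: measurable_sum => i.
have mi : measurable_fun setT (fun q : Theta * N.-tuple T => (q.1, tnth q.2 i)).
  apply: measurable_fun_pair => //.
  exact: (measurableT_comp (measurable_tnth i) measurable_snd).
exact: (measurableT_comp (mf r) mi).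
Qed.

Lemma measurable_deviation_sample r th :
  measurable_fun setT (fun z : N.-tuple T => deviation r th z).
Proof.
exact: (measurableT_comp (measurable_deviation r) (pair1_measurable th)).
Qed.

Lemma Rintegral_deviation r th : \int[power_prob D N]_z deviation r th z = 0.
Proof.
have szI : size (index_enum 'I_N) = N.
  by rewrite [index_enum _]unlock -enumT size_enum_ord.
have msum : forall s : seq 'I_N, measurable_fun setT
    (fun z : N.-tuple T => \sum_(i <- s) f r th (tnth z i)).
  move=> s; apply: measurable_sum => i.
  by apply: measurableT_comp => //; exact: measurable_tnth.
have ssum (s : seq 'I_N) (z : N.-tuple T) :
    `|\sum_(i <- s) f r th (tnth z i)| <= (size s)%:R.
  rewrite (le_trans (ler_norm_sum _ _ _))//.
  rewrite (@le_trans _ _ (\sum_(i <- s) 1))//; first exact: ler_sum.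
  by rewrite big_const_seq count_predT iter_addr_0.
have isum (s : seq 'I_N) : \int[power_prob D N]_z (\sum_(i <- s) f r th (tnth z i))
    = (size s)%:R * \int[D]_p f r th p.
  elim: s => [|i s IH].
    by under eq_Rintegral do rewrite big_nil; rewrite Rintegral_cst1 mul0r.
  under eq_Rintegral do rewrite big_cons.
  rewrite RintegralD//; last 2 first.
  - apply: (@integrable_bounded _ _ _ _ _ 1) => //.
    by apply: measurableT_comp => //; exact: measurable_tnth.
  - exact: integrable_bounded (ssum s).
  by rewrite IH (@Rintegral_power_tnth _ _ _ _ _ _ _ 1)// /= -[(size s).+1]add1n
    natrD mulrDl mul1r.
rewrite /deviation RintegralB//; last 2 first.
- exact: (@integrable_bounded _ _ _ _ _ `|\int[D]_p f r th p|).
- apply: (@integrable_bounded _ _ _ _ _ 1).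
    by apply: measurable_funM.
  move=> z; rewrite normrM ger0_norm ?invr_ge0// ler_pdivrMl// mulr1.
  by rewrite (le_trans (ssum _ _))// szI.
rewrite Rintegral_cst1 RintegralZl//; last exact: integrable_bounded (ssum _).
by rewrite isum szI mulrA mulVf ?mul1r ?subrr// gt_eqF.
Qed.

Lemma bounded_differences_mean (g : T -> R) (c : R) :
  (forall x y, g x - g y <= c) ->
  bounded_differences (fun z : N.-tuple T => - (N%:R^-1 * \sum_(i < N) g (tnth z i)))
    (c / N%:R).
Proof.
move=> gc i z z' zz'.
rewrite opprK addrC -mulrBr -sumrB (bigD1 i)//= big1 ?addr0; last first.
  by move=> j ji; rewrite zz'// subrr.
by rewrite mulrC ler_pM2r ?invr_gt0.
Qed.

Lemma bounded_differences_deviation r th :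
  bounded_differences (deviation r th) N%:R^-1.
Proof.
move=> i z z' zz'; rewrite -[leRHS]mul1r.
have f1 x y : f r th x - f r th y <= 1.
  by have /andP[] := f01 r th x; have /andP[] := f01 r th y; lra.
apply: le_trans (@bounded_differences_mean _ _ f1 i z z' zz').
by rewrite /deviation; lra.
Qed.

(** By the Lipschitz property [f r th - f r' th] ranges over an interval of length
    [2 * L * |r - r'|], so neighbouring grid points give increments that are stable in proportion to
    the mesh. *)
Lemma bounded_differences_deviationB r r' th :
  bounded_differences (fun z => deviation r th z - deviation r' th z)
    (2 * L * `|r - r'| / N%:R).
Proof.
move=> i z z' zz'.
have f1 x y : (f r th x - f r' th x) - (f r th y - f r' th y)
    <= 2 * L * `|r - r'|.
  have := fL r r' th x; have := fL r r' th y; rewrite !ler_norml.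
  by move=> /andP[? ?] /andP[? ?]; lra.
apply: le_trans (@bounded_differences_mean _ _ f1 i z z' zz').
by rewrite /deviation !sumrB; lra.
Qed.

End deviation.

(* [x <= expR (x - 1)], applied to [x = Y / s] *)
Lemma Rintegral_pos_part_le {d} {T : measurableType d} {R : realType}
    (P : probability T R) (Y : T -> R) (M s : R) :
  measurable_fun setT Y -> (forall t, `|Y t| <= M) -> 0 < s ->
  \int[P]_t expR (s^-1 * Y t) <= expR (2^-1) ->
  \int[P]_t Num.max 0 (Y t) <= s * expR (- 2^-1).
Proof.
move=> mY YM s0 mgf.
have eM t : `|expR (s^-1 * Y t)| <= expR (`|s^-1| * M) by exact: norm_expR_le.
have meY := measurable_expRM s^-1 Y mY.
apply: (@le_trans _ _ (\int[P]_t (s * expR (- 1) * expR (s^-1 * Y t)))).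
  apply: (@Rintegral_le _ _ _ _ _ _ M (s * expR (- 1) * expR (`|s^-1| * M))).
  - exact: measurable_maxr.
  - exact: measurable_funM.
  - move=> t; rewrite (le_trans _ (YM t))//.
    by have [?|?] := leP 0 (Y t); rewrite ?normr0.
  - move=> t; rewrite normrM ger0_norm ?mulr_ge0 ?expR_ge0// ?(ltW s0)//.
    by rewrite ler_pM2l ?mulr_gt0 ?expR_gt0.
  - move=> t; rewrite ge_max mulr_ge0 ?mulr_ge0 ?expR_ge0 ?(ltW s0)//=.
    rewrite -mulrA -expRD -ler_pdivrMl//.
    by have := expR_ge1Dx (- 1 + s^-1 * Y t); rewrite addrA subrr add0r.
rewrite RintegralZl//; last exact: integrable_bounded eM.
rewrite -mulrA ler_pM2l//.
have -> : - 2^-1 = - 1 + 2^-1 :> R by lra.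
by rewrite expRD ler_pM2l ?expR_gt0.
Qed.

Lemma Rintegral_sum_le {d} {T : measurableType d} {R : realType}
    (P : probability T R) (I : Type) (s : seq I) (h : I -> T -> R) (M c : R) :
  (forall i, measurable_fun setT (h i)) -> (forall i t, `|h i t| <= M) ->
  (forall i, \int[P]_t h i t <= c) ->
  \int[P]_t (\sum_(i <- s) h i t) <= (size s)%:R * c.
Proof.
move=> mh hM hc.
have sM (r : seq I) t : `|\sum_(i <- r) h i t| <= (size r)%:R * M.
  rewrite (le_trans (ler_norm_sum _ _ _))//.
  elim: r => [|i r IH]; first by rewrite big_nil mul0r.
  by rewrite big_cons /= -[(size r).+1]add1n natrD mulrDl mul1r lerD.
elim: s => [|i s IH].
  by under eq_Rintegral do rewrite big_nil; rewrite Rintegral_cst1 mul0r.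
under eq_Rintegral do rewrite big_cons.
rewrite RintegralD//; last 2 first.
- exact: integrable_bounded (hM i).
- by apply: integrable_bounded (sM s); exact: measurable_sum.
by rewrite /= -[(size s).+1]add1n natrD mulrDl mul1r lerD.
Qed.

(** Invert [expR 2^-1 >= 1 + 2^-1]. *)
Lemma expRN2V_le {R : realType} : expR (- 2^-1) <= 2 / 3 :> R.
Proof.
rewrite expRN; have := @expR_ge1Dx R 2^-1 => h.
have -> : 2 / 3 = (1 + 2^-1)^-1 :> R by field.
by rewrite lef_pV2// posrE ?expR_gt0//; lra.
Qed.

(** * Maximal deviation over a grid of thresholds *)

Section gap.
Context {d dT} {T : measurableType d} {Theta : measurableType dT} {R : realType}.
Variables (D : probability T R) (P : probability Theta R) (N : nat).
Hypothesis N_gt0 : (0 < N)%N.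
Variables (f : R -> Theta -> T -> R) (L beta : R).
Hypothesis mf : forall r, measurable_fun setT (fun q : Theta * T => f r q.1 q.2).
Hypothesis f01 : forall r th p, 0 <= f r th p <= 1.
Hypothesis L_ge0 : 0 <= L.
Hypothesis fL : forall r r' th p, `|f r th p - f r' th p| <= L * `|r - r'|.
Hypothesis beta_gt0 : 0 < beta.

Let N0 : (0 : R) < N%:R. Proof. by rewrite ltr0n. Qed.

(* The increments contribute a fraction [expR (- 2^-1) <= 2 / 3] of the target
   [2 beta L / sqrt N]; with [6 N] steps the discretization error [2 L mesh] is at
   most the remaining third. *)
Local Notation K := (6 * N)%N.
Let K0 : (0 : R) < K%:R. Proof. by rewrite ltr0n muln_gt0. Qed.

Definition mesh : R := 2 * beta / K%:R.
Definition grid (k : nat) : R := - beta + k%:R * mesh.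

Let mesh_gt0 : 0 < mesh. Proof. by rewrite divr_gt0// mulr_gt0. Qed.

(** A maximum over [R] has no neutral element, so the value at [grid 0], itself one of the terms,
    serves as the initial one. *)
Definition gap (th : Theta) (z : N.-tuple T) : R :=
  \big[Num.max/deviation D N f (grid 0) th z]_(k < K.+1)
    deviation D N f (grid k) th z.

Lemma grid_approx r : `|r| <= beta -> exists2 k, (k <= K)%N & `|r - grid k| <= mesh.
Proof.
rewrite ler_norml => /andP[br rb].
have x0 : 0 <= (r + beta) / mesh.
  by apply: divr_ge0; [lra | exact: ltW].
(* The grid point just below [r]; [r = beta] needs the index [K] itself, hence the [K.+1] grid
   points. *)
have /andP[k1 k2] := truncn_itv x0.
set k := Num.truncn _ in k1 k2; exists k.
  rewrite -(ler_nat R) (le_trans k1)// ler_pdivrMr// /mesh mulrC divfK ?gt_eqF//.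
  lra.
move: k1 k2; rewrite ler_pdivlMr// ltr_pdivrMr// -natr1 mulrDl mul1r => k1 k2.
by rewrite /grid ger0_norm; lra.
Qed.

(** This holds for each [z] and all [r] at once, so [r] may later be computed from the sample. *)
Lemma deviation_le_gap r th z : `|r| <= beta ->
  deviation D N f r th z <= gap th z + 2 * L * mesh.
Proof.
move=> /grid_approx[k kK rk].
have kgap : deviation D N f (grid k) th z <= gap th z.
  have kK1 : (k < K.+1)%N by [].
  exact: (@le_bigmax _ _ _ _ (fun i : 'I_K.+1 => deviation D N f (grid i) th z)
    (Ordinal kK1)).
have := deviation_lipschitz D N N_gt0 f L mf f01 fL r (grid k) th z.
rewrite ler_norml => /andP[_ h].
have : 2 * L * `|r - grid k| <= 2 * L * mesh by rewrite ler_wpM2l// mulr_ge0.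
by lra.
Qed.

Lemma gap_norm_le1 th z : `|gap th z| <= 1.
Proof.
have dev1 r : - 1 <= deviation D N f r th z <= 1.
  by rewrite -ler_norml; exact: deviation_le1.
rewrite ler_norml; apply/andP; split.
  apply: (@le_trans _ _ (deviation D N f (grid 0) th z)).
    by have /andP[] := dev1 (grid 0).
  exact: bigmax_ge_id.
by apply: bigmax_le => [|i _]; have /andP[] := dev1 (grid 0); last
  have /andP[] := dev1 (grid i).
Qed.

Lemma measurable_gap :
  measurable_fun setT (fun q : Theta * N.-tuple T => gap q.1 q.2).
Proof.
by apply: measurable_bigmaxr => [|i]; exact: (measurable_deviation D P).
Qed.

Lemma bounded_differences_gap th : bounded_differences (gap th) N%:R^-1.
Proof.
move=> i z z' zz'; rewrite lerBlDr.
have bd r : deviation D N f r th z <= N%:R^-1 + deviation D N f r th z'.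
  rewrite -lerBlDr.
  exact: (bounded_differences_deviation D N N_gt0 f f01 r th i z z' zz').
apply: bigmax_le => [|j _]; apply: (le_trans (bd _)); rewrite lerD2l.
  exact: bigmax_ge_id.
exact: (@le_bigmax _ _ _ _ (fun i : 'I_K.+1 => deviation D N f (grid i) th z') j).
Qed.

Let increment j th z :=
  Num.max 0 (deviation D N f (grid j.+1) th z - deviation D N f (grid j) th z).

(** Telescope from [grid 0] and keep only positive parts: the resulting bound is the same for every
    grid point, hence holds for the maximum. *)
Lemma gap_le_increments th z :
  gap th z <= deviation D N f (grid 0) th z + \sum_(j < K) increment j th z.
Proof.
have inc0 j : 0 <= increment j th z by rewrite le_max lexx.
have upto k : deviation D N f (grid k) th z <=
    deviation D N f (grid 0) th z + \sum_(0 <= j < k) increment j th z.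
  elim: k => [|k IH]; first by rewrite big_geq// addr0.
  rewrite big_nat_recr//= addrA -lerBlDl.
  rewrite (@le_trans _ _
    (deviation D N f (grid k.+1) th z - deviation D N f (grid k) th z))//.
    by rewrite lerB.
  by rewrite le_max lexx orbT.
have le_sum k : (k <= K)%N ->
    \sum_(0 <= j < k) increment j th z <= \sum_(j < K) increment j th z.
  move=> kK; rewrite -(big_mkord xpredT (fun j => increment j th z)).
  by rewrite (big_cat_nat (leq0n k) kK)/= lerDl sumr_ge0.
apply: bigmax_le => [|k _]; first by rewrite lerDl sumr_ge0.
by apply: (le_trans (upto k)); rewrite lerD2l le_sum// -ltnS.
Qed.

Lemma Rintegral_increment_le j th :
  \int[power_prob D N]_z increment j th z <=
  L * mesh / Num.sqrt N%:R * expR (- 2^-1).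
Proof.
have mY : measurable_fun setT (fun z : N.-tuple T =>
    deviation D N f (grid j.+1) th z - deviation D N f (grid j) th z).
  by apply: measurable_funB; exact: (measurable_deviation_sample D P).
have gridB : `|grid j.+1 - grid j| = mesh.
  rewrite /grid -natr1 mulrDl mul1r opprD addrACA subrr add0r addrAC subrr add0r.
  by rewrite gtr0_norm.
have YM z : `|deviation D N f (grid j.+1) th z - deviation D N f (grid j) th z|
    <= 2 * L * mesh.
  by rewrite -gridB; exact: deviation_lipschitz.
have sN : 0 < Num.sqrt N%:R :> R by rewrite sqrtr_gt0.
(* For [L = 0] the increments vanish, while the scale used below would not be positive. *)
move: L_ge0; rewrite le_eqVlt => /predU1P[L0|L0].
  rewrite -L0 !mul0r (_ : (fun z => _) = cst 0) ?Rintegral_cst1//.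
  apply/funext => z; rewrite /increment.
  by have := YM z; rewrite -L0 mulr0 mul0r normr_le0 => /eqP ->; rewrite maxxx.
(* The scale is [s = L * mesh / Num.sqrt N%:R]. With differences [2 * L * mesh / N%:R] and mean
   zero, the McDiarmid exponent at [l = s^-1] is exactly [2^-1]. *)
apply: (Rintegral_pos_part_le _ _ _ _ mY YM); first by rewrite !mulr_gt0 ?invr_gt0.
apply: (le_trans (mcdiarmid_mgf D N _ _ _ mY YM
  (bounded_differences_deviationB D N N_gt0 f L fL _ _ th) _)).
rewrite ler_expR RintegralB; last 3 first.
- exact: measurableT.
- apply: (@integrable_bounded _ _ _ _ _ 1).
    exact: (measurable_deviation_sample D P).
  by move=> z; exact: deviation_le1.
- apply: (@integrable_bounded _ _ _ _ _ 1).
    exact: (measurable_deviation_sample D P).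
  by move=> z; exact: deviation_le1.
rewrite !Rintegral_deviation// subrr mulr0 add0r gridB.
have N2 : Num.sqrt N%:R ^+ 2 = N%:R :> R by rewrite sqr_sqrtr.
rewrite -{1 3}N2 le_eqVlt; apply/orP; left; apply/eqP.
by field; rewrite !gt_eqF.
Qed.

Lemma Rintegral_gap_le th :
  \int[power_prob D N]_z gap th z + 2 * L * mesh <= 2 * beta * L / Num.sqrt N%:R.
Proof.
set mu := power_prob D N.
have mdev r : measurable_fun setT (deviation D N f r th).
  exact: (measurable_deviation_sample D P).
have dev1 r z : `|deviation D N f r th z| <= 1 by exact: deviation_le1.
have minc (j : 'I_K) : measurable_fun setT (increment j th).
  by apply: measurable_maxr => //; exact: measurable_funB.
have inc2 (j : 'I_K) z : `|increment j th z| <= 2.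
  rewrite ger0_norm ?le_max ?lexx// ge_max ler0n/=.
  rewrite (le_trans (ler_norm _))// (le_trans (ler_normB _ _))//.
  by have := dev1 (grid j.+1) z; have := dev1 (grid j) z; lra.
set c := L * mesh / Num.sqrt N%:R * expR (- 2^-1).
have sum_le : \int[mu]_z (\sum_(j < K) increment j th z) <= K%:R * c.
  have := Rintegral_sum_le mu _ (index_enum 'I_K) (fun j z => increment j th z) 2 c
    minc inc2 (fun j => Rintegral_increment_le j th).
  by rewrite [index_enum _]unlock -enumT size_enum_ord.
have msum : measurable_fun setT (fun z => \sum_(j < K) increment j th z).
  exact: measurable_sum.
have sumM z : `|\sum_(j < K) increment j th z| <= K%:R * 2.
  rewrite (le_trans (ler_norm_sum _ _ _))//.
  rewrite (@le_trans _ _ (\sum_(j < K) 2))//; first exact: ler_sum.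
  by rewrite sumr_const card_ord mulr_natl.
have gap_le : \int[mu]_z gap th z <= K%:R * c.
  apply: (@le_trans _ _
      (\int[mu]_z (deviation D N f (grid 0) th z + \sum_(j < K) increment j th z))).
    apply: (@Rintegral_le _ _ _ _ _ _ 1 (1 + K%:R * 2)).
    - exact: (measurableT_comp measurable_gap (pair1_measurable th)).
    - exact: measurable_funD.
    - exact: gap_norm_le1.
    - by move=> z; rewrite (le_trans (ler_normD _ _))// lerD.
    - exact: gap_le_increments.
  rewrite RintegralD//; last 2 first.
  - exact: integrable_bounded (dev1 _).
  - exact: integrable_bounded sumM.
  by rewrite Rintegral_deviation// add0r.
set S := Num.sqrt N%:R; have S1 : 1 <= S.
  by rewrite -sqrtr1 ler_sqrt// ler1n.
have S0 : 0 < S by exact: lt_le_trans S1.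
have S2 : N%:R = S ^+ 2 :> R by rewrite sqr_sqrtr.
(* As [K%:R * mesh = 2 * beta], refining the grid would not change this term; only the
   discretization error depends on [K]. *)
have Kc : K%:R * c = 2 * beta * L / S * expR (- 2^-1).
  rewrite /c /mesh -/S natrM S2; field.
  by rewrite gt_eqF.
have meshE : 2 * L * mesh = 2 * beta * L / S * (3^-1 / S).
  by rewrite /mesh natrM S2; field; rewrite gt_eqF.
apply: (le_trans (lerD gap_le (lexx _))); rewrite Kc meshE -mulrDr.
rewrite ler_piMr ?mulr_ge0 ?invr_ge0 ?(ltW S0) ?(ltW beta_gt0)//.
have S3 : 3^-1 / S <= 3^-1 by rewrite ler_pdivrMr// ler_peMr.
by have := @expRN2V_le R; lra.
Qed.

Definition centered_gap (th : Theta) (z : N.-tuple T) : R :=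
  gap th z - \int[power_prob D N]_z' gap th z'.

Lemma measurable_centered_gap :
  measurable_fun setT (fun q : Theta * N.-tuple T => centered_gap q.1 q.2).
Proof.
apply: measurable_funB; first exact: measurable_gap.
apply: (measurableT_comp (f := fun th => \int[power_prob D N]_z' gap th z')) => //.
apply: (@measurable_Rintegral_section _ _ _ _ _ P (power_prob D N)
  (fun q => gap q.1 q.2) 1); first exact: measurable_gap.
by move=> q; exact: gap_norm_le1.
Qed.

Lemma centered_gap_le2 th z : `|centered_gap th z| <= 2.
Proof.
rewrite (le_trans (ler_normB _ _))// (_ : 2 = 1 + 1 :> R)// lerD//.
  exact: gap_norm_le1.
apply: normr_Rintegral_le; last by move=> ?; exact: gap_norm_le1.
exact: (measurableT_comp measurable_gap (pair1_measurable th)).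
Qed.

(** McDiarmid's bound gives the variance proxy [v = 4^-1 / N%:R]. With the factor [2 * (N%:R - 1)]
    on the square, [1 - 2 * c * v] becomes [N%:R^-1], whence [Num.sqrt N%:R]. *)
Lemma centered_gap_sq_mgf th :
  (\int[power_prob D N]_z (expR (2 * (N%:R - 1) * centered_gap th z ^+ 2))%:E <=
   (Num.sqrt N%:R)%:E)%E.
Proof.
have mg : measurable_fun setT (gap th).
  exact: (measurableT_comp measurable_gap (pair1_measurable th)).
have mcg : measurable_fun setT (centered_gap th) by exact: measurable_funB.
have N1 : 1 <= N%:R :> R by rewrite ler1n.
have vE : 2 * (2 * (N%:R - 1)) * (4^-1 / N%:R) = 1 - N%:R^-1 :> R.
  by field; rewrite gt_eqF.
have := subgaussian_sq_mgf (power_prob D N) (centered_gap th) (4^-1 / N%:R)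
  (2 * (N%:R - 1)) mcg; rewrite vE opprB addrCA subrr addr0 sqrtrV// invrK.
apply.
- by rewrite mulr_ge0// subr_ge0.
- by rewrite ltrBlDr ltrDl invr_gt0.
move=> l; rewrite -(EFin_Rintegral _ _ (expR (`|l| * 2))); last 2 first.
- exact: measurable_expRM.
- by move=> z; apply: norm_expR_le; exact: centered_gap_le2.
rewrite lee_fin /centered_gap.
set m := \int[_]_z gap th z.
have eM z : `|expR (l * gap th z)| <= expR (`|l| * 1).
  by apply: norm_expR_le; exact: gap_norm_le1.
under eq_Rintegral do rewrite mulrBr expRD.
rewrite RintegralZr//; last first.
  by apply: integrable_bounded eM; exact: measurable_expRM.
have := mcdiarmid_mgf D N (gap th) 1 N%:R^-1 mg (gap_norm_le1 th)
  (bounded_differences_gap th) l.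
rewrite -/m => h; rewrite -ler_pdivlMr ?expR_gt0// expRN invrK -expRD.
apply: (le_trans h); rewrite ler_expR addrC lerD2r le_eqVlt.
by apply/orP; left; apply/eqP; field; rewrite gt_eqF.
Qed.

End gap.

(** * The PAC-Bayes bound *)

(** Jensen's inequality for the square, by integrating the nonnegative function [(|g| - m) ^+ 2]. *)
Lemma Rintegral_norm_sqr_le {d} {T : measurableType d} {R : realType}
    (Q : probability T R) (g : T -> R) (M : R) :
  measurable_fun setT g -> (forall t, `|g t| <= M) ->
  (\int[Q]_t `|g t|) ^+ 2 <= \int[Q]_t (g t ^+ 2).
Proof.
move=> mg gM; set m := \int[Q]_t `|g t|.
have mng : measurable_fun setT (fun t => `|g t|) by exact: measurableT_comp.
have i1 : Q.-integrable setT (EFin \o (fun t => `|g t|)).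
  by apply: (@integrable_bounded _ _ _ _ _ M) => // t; rewrite normr_id.
have i2 : Q.-integrable setT (EFin \o (fun t => g t ^+ 2)).
  apply: (@integrable_bounded _ _ _ _ _ (M ^+ 2)); first exact: measurable_funX.
  move=> t; rewrite normrX; have := gM t; have := normr_ge0 (g t) => ? ?.
  by rewrite lerXn2r ?nnegrE// (le_trans _ (gM t)).
have i3 (k : R) : Q.-integrable setT (EFin \o (fun t => k * `|g t|)).
  apply: (@integrable_bounded _ _ _ _ _ (`|k| * M)); first exact: measurable_funM.
  by move=> t; rewrite normrM normr_id ler_wpM2l.
have i4 (k : R) : Q.-integrable setT (EFin \o (fun _ : T => k)).
  exact: (@integrable_bounded _ _ _ _ _ `|k|).
have i5 : Q.-integrable setT (EFin \o (fun t => g t ^+ 2 - 2 * m * `|g t|)).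
  have := integrableB measurableT i2 (i3 (2 * m)).
  by apply: eq_integrable => // t _; rewrite /= EFinB.
have : 0 <= \int[Q]_t (g t ^+ 2 - 2 * m * `|g t| + m ^+ 2).
  apply: Rintegral_ge0 => t _; rewrite -[g t ^+ 2]real_normK ?num_real//.
  by have := sqr_ge0 (`|g t| - m); rewrite sqrrB; nra.
rewrite RintegralD// RintegralB// RintegralZl// Rintegral_cst1 -/m.
by move=> h; nra.
Qed.

Section pac_bayes.
Context {d dT dO} {T : measurableType d} {Theta : measurableType dT}
  {Omega : measurableType dO} {R : realType}.
Variables (D : probability T R) (P : probability Theta R) (N : nat).
Variables (Pr : probability Omega R) (Z : 'I_N -> {RV Pr >-> T}).
Hypothesis N_ge2 : (2 <= N)%N.
Hypothesis iidZ : iid D Z.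
Variables (g : Theta -> N.-tuple T -> R) (M : R).
Hypothesis mg : measurable_fun setT (fun q : Theta * N.-tuple T => g q.1 q.2).
Hypothesis gM : forall th z, `|g th z| <= M.
Hypothesis g_mgf : forall th,
  (\int[power_prob D N]_z (expR (2 * (N%:R - 1) * g th z ^+ 2))%:E <=
   (Num.sqrt N%:R)%:E)%E.
Variable gamma : R.
Hypothesis gamma_gt0 : 0 < gamma.

Let N0 : (0 : R) < N%:R. Proof. by rewrite ltr0n (ltn_trans _ N_ge2). Qed.

Let c : R := 2 * (N%:R - 1).

Let c_gt0 : 0 < c. Proof. by rewrite mulr_gt0// subr_gt0 ltr1n. Qed.

Let H (q : Theta * N.-tuple T) : R := expR (c * g q.1 q.2 ^+ 2).

Let mcg : measurable_fun setT (fun q : Theta * N.-tuple T => c * g q.1 q.2 ^+ 2).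
Proof. by apply: measurable_funM => //; exact: measurable_funX. Qed.

Let mH : measurable_fun setT H.
Proof. exact: measurableT_comp. Qed.

Let cgM th z : `|c * g th z ^+ 2| <= c * M ^+ 2.
Proof.
rewrite normrM gtr0_norm// ler_pM2l// normrX lerXn2r ?nnegrE//.
exact: le_trans (gM th z).
Qed.

Let HM q : `|H q| <= expR (c * M ^+ 2).
Proof.
rewrite ger0_norm ?expR_ge0// ler_expR; exact: le_trans (ler_norm _) (cgM _ _).
Qed.

(** This prior average does not involve [Q], so a single event controlling it serves all [Q]. *)
Let W (z : N.-tuple T) : R := \int[P]_th H (th, z).

Let mW : measurable_fun setT W.
Proof.
apply: (@measurable_Rintegral_section _ _ _ _ _ (power_prob D N) P
  (fun q => H (q.2, q.1)) (expR (c * M ^+ 2))) => //.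
exact: (measurableT_comp mH (@measurable_swap _ _ _ _)).
Qed.

Let mHz z : measurable_fun setT (fun th => H (th, z)).
Proof. exact: (measurableT_comp mH (pair2_measurable z)). Qed.

Let W_ge1 z : 1 <= W z.
Proof.
rewrite -[leLHS](Rintegral_cst1 P).
apply: (@Rintegral_le _ _ _ _ _ _ `|1| (expR (c * M ^+ 2))) => // th.
by rewrite -expR0 ler_expR mulr_ge0 ?sqr_ge0// ltW.
Qed.

(** The prior is independent of the sample, so Tonelli's theorem puts the integral over samples
    inside, where [g_mgf] applies to each [th]. *)
Let integral_W : (\int[Pr]_w (W (sample Z w))%:E <= (Num.sqrt N%:R)%:E)%E.
Proof.
rewrite (ge0_integral_sample D _ Z (EFin \o W))//; last 2 first.
- exact/measurable_EFinP.
- by move=> z; rewrite lee_fin (le_trans _ (W_ge1 z)).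
have -> : (\int[power_prob D N]_z (EFin \o W) z =
    \int[power_prob D N]_z \int[P]_th (H (th, z))%:E)%E.
  by apply: eq_integral => z _; exact: EFin_Rintegral.
rewrite -(fubini_tonelli (EFin \o H)); last 2 first.
- exact/measurable_EFinP.
- by move=> q; rewrite lee_fin expR_ge0.
have -> : (Num.sqrt N%:R)%:E = (\int[P]_th (Num.sqrt N%:R)%:E)%E.
  by rewrite -(EFin_Rintegral _ _ `|Num.sqrt N%:R|)// Rintegral_cst1.
apply: ge0_le_integral => //.
- by move=> th _; apply: integral_ge0 => z _; rewrite lee_fin expR_ge0.
- apply: (measurable_fun_fubini_tonelli_F (EFin \o H)).
    exact/measurable_EFinP.
  by move=> q; rewrite lee_fin expR_ge0.
- by move=> th _; exact: g_mgf.
Qed.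

Let A : set Omega := [set w | W (sample Z w) < 2 * N%:R / gamma].

Let mWs : measurable_fun setT (fun w => W (sample Z w)).
Proof. exact: (measurableT_comp mW (measurable_sample Z)). Qed.

Let mA : measurable A.
Proof.
have -> : A = (fun w => W (sample Z w)) @^-1` `]-oo, 2 * N%:R / gamma[.
  by apply/seteqP; split=> w /=; rewrite in_itv.
by rewrite -[X in measurable X]setTI; apply: mWs => //; exact: measurable_itv.
Qed.

Let t0 : 0 < 2 * N%:R / gamma.
Proof. by rewrite divr_gt0// mulr_gt0. Qed.

(** By Markov's inequality the complement has probability at most [gamma / (2 * Num.sqrt N%:R)],
    hence at most [gamma / 2]; the factor 2 makes the final inequality strict. *)
Let Pr_A : ((1 - gamma)%:E < Pr A)%E.
Proof.
have PrAC : ((2 * N%:R / gamma)%:E * Pr (~` A) <= (Num.sqrt N%:R)%:E)%E.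
  apply: le_trans integral_W.
  have -> : Pr (~` A) = (\int[Pr]_w (\1_(~` A) w)%:E)%E.
    by rewrite integral_indic ?setIT//; exact: measurableC.
  rewrite -ge0_integralZl_EFin//; last first.
  - exact: ltW.
  - by apply/measurable_EFinP; apply: measurable_indic; exact: measurableC.
  apply: ge0_le_integral => //.
  - by move=> w _; rewrite mule_ge0// lee_fin ltW.
  - apply: measurable_funeM.
    by apply/measurable_EFinP; apply: measurable_indic; exact: measurableC.
  - exact/measurable_EFinP.
  - move=> w _; rewrite -EFinM lee_fin indicE; case: (boolP (w \in ~` A)).
      by rewrite inE /A /= => /negP; rewrite -leNgt mulr1.
    by rewrite mulr0 (le_trans _ (W_ge1 _)).
have fA : Pr A \is a fin_num by exact: fin_num_measure.
move: PrAC; rewrite probability_setC// -(fineK fA) -EFinB -EFinM !lee_fin lte_fin.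
set p := fine _; set S := Num.sqrt _ => h.
have S2 : N%:R = S ^+ 2 :> R by rewrite sqr_sqrtr// ltW.
have S1 : 1 <= S by rewrite -sqrtr1 ler_sqrt// ler1n (ltn_trans _ N_ge2).
move: h; rewrite mulrAC ler_pdivrMr// S2 => h.
have : 2 * S * (1 - p) <= gamma.
  have S0 : 0 < S by exact: lt_le_trans S1.
  by rewrite -(ler_pM2l S0); lra.
move=> h2; have [p1|p1] := leP p 1; last by rewrite (lt_trans _ p1)// ltrBlDr ltrDl.
have h3 : 0 <= (S - 1) * (1 - p) by rewrite mulr_ge0// subr_ge0.
have h4 : 1 - p <= gamma / 2 by lra.
by rewrite ltrBlDr addrC -ltrBlDr (le_lt_trans h4)// ltr_pdivrMr// ltr_pMr// ltr1n.
Qed.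

Lemma pac_bayes_event : exists B : set Omega,
  [/\ measurable B, ((1 - gamma)%:E < Pr B)%E &
   forall w, B w -> forall Q : probability Theta R,
   ((\int[Q]_th `|g th (sample Z w)|)%:E <=
    sqrte (2^-1%:E * KL Q P + (2^-1 * ln (2 * N%:R / gamma))%:E)
    * ((Num.sqrt (N%:R - 1))^-1)%:E)%E].
Proof.
exists A; split => // w Aw Q; set z := sample Z w.
have N1 : (0 : R) < N%:R - 1 by rewrite subr_gt0 ltr1n.
have sN1 : 0 < (Num.sqrt (N%:R - 1))^-1 :> R by rewrite invr_gt0 sqrtr_gt0.
have mcgz : measurable_fun setT (fun th => c * g th z ^+ 2).
  exact: (measurableT_comp mcg (pair2_measurable z)).
have mgz : measurable_fun setT (fun th => g th z).
  exact: (measurableT_comp mg (pair2_measurable z)).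
have := donsker_varadhan Q P _ _ mcgz (fun th => cgM th z).
rewrite -/(W z) RintegralZl//; last first.
  apply: (@integrable_bounded _ _ _ _ _ (M ^+ 2)); first exact: measurable_funX.
  move=> th; rewrite normrX lerXn2r ?nnegrE//; exact: le_trans (gM th z).
set V := Rintegral _ _ _ => DV.
have lnW : ln (W z) <= ln (2 * N%:R / gamma).
  by rewrite ler_ln ?posrE// ?ltW// (lt_le_trans _ (W_ge1 z)).
have mV : (\int[Q]_th `|g th z|) ^+ 2 <= V by exact: Rintegral_norm_sqr_le (gM^~ z).
set m := Rintegral _ _ _ in mV *.
have m0 : 0 <= m by apply: Rintegral_ge0.
(* An infinite divergence makes the bound trivial; the value [-oo] contradicts [DV]. *)
case: (KL Q P) DV => [r|_|]; last 2 first.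
- by rewrite gt0_muley ?lte_fin// addye// gt0_mulye ?lte_fin// leey.
- by rewrite addNye leeNy_eq.
rewrite -EFinD lee_fin => DV.
rewrite -EFinM lee_fin.
set B := 2^-1 * r + _.
have VB : (N%:R - 1) * V <= B.
  by move: DV lnW; rewrite /c /B; lra.
(* The radicand is nonnegative because it dominates [(N%:R - 1) * V]; the bound then follows by
   comparing squares. *)
have B0 : 0 <= B.
  rewrite (le_trans _ VB)// mulr_ge0 ?(ltW N1)//.
  by rewrite (le_trans _ mV)// sqr_ge0.
rewrite ler_pdivlMr ?sqrtr_gt0// -[m]ger0_norm// -sqrtr_sqr -sqrtrM ?sqr_ge0//.
rewrite ler_sqrt//; apply: le_trans VB; rewrite mulrC ler_pM2l//.
Qed.

End pac_bayes.

(** * The bound at the calibrated threshold *)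

Theorem theorem2 (R : realType) (dX dY dO : measure_display)
  (X : measurableType dX) (Y : measurableType dY) (Omega : measurableType dO)
  (d : nat) (D : probability (X * Y)%type R)
  (s : X -> Y -> d.-tuple R -> R)
  (measurable_s : measurable_fun [set: X * Y * d.-tuple R]
     (fun p : X * Y * d.-tuple R => s p.1.1 p.1.2 p.2))
  (leff : set Y -> R)
  (measurable_leff : forall tau : R, measurable_fun [set: X * d.-tuple R]
     (fun p : X * d.-tuple R => leff (prediction_set s p.1 tau p.2)))
  (P : probability (d.-tuple R) R)
  (Pr : probability Omega R)
  (N : nat) (N_ge2 : (2 <= N)%N)
  (Z : 'I_N -> {RV Pr >-> (X * Y)%type}) (iid_Z : iid D Z)
  (gamma : R) (gamma_gt0 : 0 < gamma)
  (alpha : R) (alpha_gt0 : 0 < alpha) (alpha_lt1 : alpha < 1)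
  (alpha_N : 1 <= N.+1%:R * alpha)
  (leff_01 : forall (x : X) (tau : R) (th : d.-tuple R),
     0 <= leff (prediction_set s x tau th) <= 1)
  (beta : R)
  (s_bounded : forall (x : X) (y : Y) (th : d.-tuple R), `|s x y th| < beta)
  (L : R)
  (leff_lipschitz : forall (x : X) (th : d.-tuple R),
     L.-lipschitz (fun tau : R => leff (prediction_set s x tau th))) :
  exists A : set Omega,
    [/\ measurable A,
        ((1 - gamma)%:E < Pr A)%E &
        forall w : Omega, A w -> forall Q : probability (d.-tuple R) R,
          (exp_eff D s leff (fun i => Z i w) alpha Q <=
             \int[Q]_th (emp_eff s leff (fun i => Z i w) alpha th)%:E
             + (2 * beta * L / Num.sqrt N%:R)%:E
             + sqrte (2^-1%:E * KL Q P + (2^-1 * ln (2 * N%:R / gamma))%:E)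
               * ((Num.sqrt (N%:R - 1))^-1)%:E)%E].
Proof.
(* A point of the sample space supplies an input and a label, from which the signs of [beta] and [L]
   follow. *)
have [w0 _] := probability_inhabited Pr.
have N0 : (0 < N)%N by exact: ltn_trans N_ge2.
pose i0 := Ordinal N0.
have beta0 : 0 < beta.
  exact: le_lt_trans (s_bounded (Z i0 w0).1 (Z i0 w0).2 [tuple 0 | _ < d]).
have leffL r r' th x : `|leff (prediction_set s x r th) -
    leff (prediction_set s x r' th)| <= L * `|r - r'|.
  exact: (leff_lipschitz x th (r, r')).
have L0 : 0 <= L.
  have := leffL 1 0 [tuple 0 | _ < d] (Z i0 w0).1.
  by rewrite subr0 normr1 mulr1; apply: le_trans.
pose f (r : R) (th : d.-tuple R) (p : X * Y) : R :=
  leff (prediction_set s p.1 r th).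
have mf r : measurable_fun setT (fun q : d.-tuple R * (X * Y) => f r q.1 q.2).
  have mq : measurable_fun setT (fun q : d.-tuple R * (X * Y) => (q.2.1, q.1)).
    apply: measurable_fun_pair => //.
    exact: (measurableT_comp measurable_fst measurable_snd).
  exact: (measurableT_comp (measurable_leff r) mq).
have f01 r th p : 0 <= f r th p <= 1 by exact: leff_01.
have fL r r' th p : `|f r th p - f r' th p| <= L * `|r - r'| by exact: leffL.
pose g := centered_gap D N f beta.
have mg : measurable_fun setT (fun q : d.-tuple R * N.-tuple (X * Y) => g q.1 q.2).
  exact: (measurable_centered_gap D P).
have gM th z : `|g th z| <= 2 by exact: (centered_gap_le2 D P).
have [A [mA PrA bound]] := pac_bayes_event D P N Pr Z N_ge2 iid_Z g 2 mg gM
  (fun th => centered_gap_sq_mgf D P N N0 f beta mf f01 th) gamma gamma_gt0.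
exists A; split => // w Aw Q.
set z := fun i => Z i w.
pose tau th := tau_star s z alpha th.
have mtau : measurable_fun setT tau.
  apply: measurable_kth_smallest => i.
  exact: (measurableT_comp measurable_s (pair1_measurable ((z i).1, (z i).2))).
(* The value is either a score or the default 0 of [nth]; both lie within [beta] of 0. *)
have tau_beta th : `|tau th| <= beta.
  rewrite /tau /tau_star /kth_smallest; set xs := map _ _.
  have xsb : {in xs, forall r, `|r| <= beta}.
    by move=> _ /mapP[i _ ->]; exact/ltW/s_bounded.
  have [k|k] := ltnP (calib_rank N alpha).-1 (size (sort <=%R xs)).
    by apply: xsb; rewrite -(mem_sort <=%R) mem_nth.
  by rewrite nth_default// normr0 ltW.
pose F (th : d.-tuple R) (p : X * Y) := f (tau th) th p.
(* Measurability is assumed for fixed thresholds only; the Lipschitz property extends it to the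
   threshold [tau th]. *)
have mF : measurable_fun setT (fun q : d.-tuple R * (X * Y) => F q.1 q.2).
  apply: (measurable_fun_lipschitz_comp
    (fun r q => f r q.1 q.2) (fun q => tau q.1) L) => //.
  exact: (measurableT_comp mtau measurable_fst).
have F1 th p : `|F th p| <= 1.
  by have /andP[F0 F1] := f01 (tau th) th p; rewrite ger0_norm.
pose m th := \int[D]_p F th p.
have mm : measurable_fun setT m.
  exact: (@measurable_Rintegral_section _ _ _ _ _ P D (fun q => F q.1 q.2) 1).
have mFth th : measurable_fun setT (F th).
  exact: (measurableT_comp mF (pair1_measurable th)).
have m1 th : `|m th| <= 1 by exact: normr_Rintegral_le.
pose e th := emp_eff s leff z alpha th.
have me : measurable_fun setT e.
  apply: measurable_funM => //; apply: measurable_sum => i.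
  exact: (measurableT_comp mF (pair2_measurable (z i))).
have Nn0 : (0 : R) < N%:R by rewrite ltr0n.
have e1 th : `|e th| <= 1.
  rewrite /e /emp_eff normrM ger0_norm ?invr_ge0// ler_pdivrMl// mulr1.
  rewrite (le_trans (ler_norm_sum _ _ _))//.
  rewrite (@le_trans _ _ (\sum_(i < N) 1))//; last by rewrite sumr_const card_ord.
  by apply: ler_sum => i _; exact: (F1 th (z i)).
have -> : exp_eff D s leff z alpha Q = (\int[Q]_th m th)%:E.
  rewrite (EFin_Rintegral Q _ _ mm m1); apply: eq_integral => th _.
  by rewrite /m (EFin_Rintegral D _ _ (mFth th) (F1 th)).
rewrite -(EFin_Rintegral Q _ _ me e1).
set b := 2 * beta * L / Num.sqrt N%:R.
set Zw := sample Z w.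
have mgw : measurable_fun setT (fun th => `|g th Zw|).
  apply: measurableT_comp => //.
  exact: (measurableT_comp mg (pair2_measurable Zw)).
have gw2 th : `| (`|g th Zw|) | <= 2 by rewrite normr_id.
apply: (@le_trans _ _ (\int[Q]_th e th + b + \int[Q]_th `|g th Zw|)%:E); last first.
  by rewrite !EFinD leeD2l//; exact: bound.
(* At [tau th] the deviation is [m th - e th]. It is at most the centered gap plus the mean gap and
   the discretization error, and the last two together are at most [b]. *)
have key th : m th <= e th + b + `|g th Zw|.
  have devE : deviation D N f (tau th) th Zw = m th - e th.
    rewrite /deviation /e /emp_eff; congr (_ - _ * _).
    by apply: eq_bigr => i _; rewrite tnth_mktuple.
  have := deviation_le_gap D N N0 f L beta mf f01 L0 fL beta0 _ th Zw (tau_beta th).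
  have := Rintegral_gap_le D P N N0 f L beta mf f01 L0 fL beta0 th.
  rewrite devE -/b; have := ler_norm (g th Zw); rewrite {1}/g /centered_gap.
  by lra.
have icst (r : R) : Q.-integrable setT (EFin \o (fun _ : d.-tuple R => r)).
  exact: (@integrable_bounded _ _ _ _ _ `|r|).
have meb : measurable_fun setT (fun th => e th + b) by exact: measurable_funD.
have ebM th : `|e th + b| <= 1 + `|b|.
  by rewrite (le_trans (ler_normD _ _))// lerD2r.
rewrite lee_fin -[X in _ + X + _](Rintegral_cst1 Q) -RintegralD//; last first.
  exact: integrable_bounded e1.
rewrite -RintegralD//; last 2 first.
- exact: integrable_bounded ebM.
- exact: integrable_bounded gw2.
apply: (@Rintegral_le _ _ _ _ _ _ 1 (1 + `|b| + 2)) => //.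
  exact: measurable_funD.
by move=> th; rewrite (le_trans (ler_normD _ _))// lerD.
Qed.
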